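(* Let $\Psi:\mathbb{R}^d\times[0,\infty)\to[0,\infty)$ be a measurable function, written $\Psi(x,t)=\Psi_x(t)=\int_0^t\psi_x(s)\,ds$, satisfying the following properties. (1) For every fixed $x\in\mathbb{R}^d$, $\Psi_x(0)=0$, $\Psi_x$ is increasing on $[0,\infty)$, $\Psi_x(t)>0$ for all $t>0$, and $\Psi_x(t)\to\infty$ as $t\to\infty$. Moreover, there exists an absolute constant $C_0>0$ such that $\Psi_x(2t)\le C_0\Psi_x(t)$ for all $x\in\mathbb{R}^d$ and all $t\in[0,\infty)$. (2) For every compact set $K\subset\mathbb{R}^d$ there exist $x_1,x_2\in K$ and a constant $C_K>0$ such that $$C_K^{-1}\,\Psi(x_2,t) \le \Psi(x_1,t)\le\Psi(x,t)\le\Psi(x_2,t)\le C_K\,\Psi(x_1,t)$$ for every $x\in K$ and all $t>0$. (3) For all $0<\alpha_0<\beta_0$ and every $x\in\mathbb{R}^d$, $\int_{\alpha_0}^{\beta_0}\frac{\psi_x(s)}{s}\,ds<\infty$. Fix a closed ball $B\subsetneq\mathbb{R}^d$ and let $f$ be a measurable function with $\mathrm{supp}(f)\subseteq B$. Then $M(f)\in L_\Psi(B)$ if, and only if, $$\int_{\{|f|>\alpha_0\}}|f(x)|\cdot\left(\int_{\alpha_0}^{|f(x)|}\frac{\psi_x(s)}{s}\,ds\right)dx<\infty$$ for every $\alpha_0>0$.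
   Context: The Hardy-Littlewood maximal function of $f$ is $M(f)(x) := \sup_{r>0} \frac{1}{|B(x,r)|}\int_{B(x,r)} |f(y)|\,dy \in [0,\infty]$, $x\in\mathbb{R}^d$, where $B(x,r)$ is the open ball with center $x$ and radius $r$, and $|A|$ denotes the Lebesgue measure of $A$. For measurable $B\subseteq\mathbb{R}^d$, $L_\Psi(B)$ is the space of all measurable functions $g$ on $B$ such that $\int_B\Psi(x,|g(x)|)\,dx<\infty$, with the convention $\Psi(x,\infty)=\infty$. *)

(* Defs.v *)
From HB Require Import structures.
From mathcomp Require Import all_boot all_order all_algebra.
From mathcomp Require Import all_classical all_reals all_analysis.
From mathcomp Require Import measurable_realfun.
Set Implicit Arguments.
Unset Strict Implicit.
Unset Printing Implicit Defensive.
Import Order.TTheory GRing.Theory Num.Theory.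
Import numFieldNormedType.Exports.
Local Open Scope classical_set_scope.
Local Open Scope ring_scope.

Definition rV_display : measure_display.
Proof. exact: default_measure_display. Qed.

Section rV_measurable.
Context {R : realType}.
Variable n : nat.

Let coor : 'I_n -> 'rV[R]_n -> measurableTypeR R := fun i x => x 0 i.

Let rV_set0 : g_sigma_preimage coor set0.
Proof. exact: sigma_algebra0. Qed.

Let rV_setC A : g_sigma_preimage coor A -> g_sigma_preimage coor (~` A).
Proof. exact: sigma_algebraC. Qed.

Let rV_bigcup (F : (set 'rV[R]_n)^nat) :
  (forall i, g_sigma_preimage coor (F i)) ->
  g_sigma_preimage coor (\bigcup_i (F i)).
Proof. exact: sigma_algebra_bigcup. Qed.

(* The Borel sigma-algebra of R^n, as generated by the coordinates (the same
   construction as for n.-tuple); it is only used to build [lebesgue_rV]. *)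
HB.instance Definition _ := @isMeasurable.Build
  rV_display 'rV[R]_n (g_sigma_preimage coor) rV_set0 rV_setC rV_bigcup.

End rV_measurable.

Section rV_measurable_fun.
Context {R : realType}.

Lemma measurable_coord n (i : 'I_n) :
  measurable_fun [set: 'rV[R]_n] (fun x => x 0 i : measurableTypeR R).
Proof.
move=> _ Y mY; rewrite setTI; apply: sub_sigma_algebra => /=.
rewrite -bigcup_seq/=; exists i => /=; first by rewrite mem_index_enum.
by exists Y => //; rewrite setTI.
Qed.

Lemma measurable_fun_rVP d (T : measurableType d) n (f : T -> 'rV[R]_n) :
  measurable_fun [set: T] f <->
  forall i, measurable_fun [set: T] (fun x => f x 0 i : measurableTypeR R).
Proof.
split=> [mf i|mf]; first exact: measurableT_comp (measurable_coord i) mf.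
apply: (@measurability _ _ _ _ setT f
  (\big[setU/set0]_(i < n) preimage_set_system setT
     (fun x : 'rV[R]_n => x 0 i : measurableTypeR R) measurable)) => //.
move=> _ [A + <-]; rewrite -bigcup_seq/= => -[i _ [B mB <-]].
by rewrite setTI -comp_preimage; have := mf i measurableT B mB.
Qed.

Definition rV_cons n (p : measurableTypeR R * 'rV[R]_n) : 'rV[R]_n.+1 :=
  row_mx (const_mx p.1 : 'rV[R]_1) p.2.

Definition rV_uncons n (x : 'rV[R]_n.+1) : measurableTypeR R * 'rV[R]_n :=
  (x 0 ord0, \row_j x 0 (lift ord0 j)).

Lemma rV_cons0 n p : @rV_cons n p 0 ord0 = p.1.
Proof.
have -> : ord0 = lshift n (ord0 : 'I_1) by exact: ord_inj.
by apply: etrans (row_mxEl _ _ _ _) _; rewrite mxE.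
Qed.

Lemma rV_consS n p j : @rV_cons n p 0 (lift ord0 j) = p.2 0 j.
Proof.
have -> : lift ord0 j = rshift 1 j by exact: ord_inj.
exact: row_mxEr.
Qed.

Lemma rV_consK n : cancel (@rV_cons n) (@rV_uncons n).
Proof.
move=> [a v]; rewrite /rV_uncons rV_cons0; congr pair.
by apply/rowP => j; rewrite mxE rV_consS.
Qed.

Lemma rV_unconsK n : cancel (@rV_uncons n) (@rV_cons n).
Proof.
move=> x; apply/rowP => i; case: (unliftP ord0 i) => [j|] ->.
  by rewrite rV_consS mxE.
by rewrite rV_cons0.
Qed.

Lemma measurable_rV_uncons n : measurable_fun setT (@rV_uncons n).
Proof.
apply: measurable_fun_pair; first exact: measurable_coord.
apply/measurable_fun_rVP => i; under eq_fun do rewrite mxE.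
exact: measurable_coord.
Qed.

Lemma measurable_rV_cons n : measurable_fun setT (@rV_cons n).
Proof.
apply/measurable_fun_rVP => i; case: (unliftP ord0 i) => [j|] ->.
  under eq_fun do rewrite rV_consS.
  exact: measurableT_comp (measurable_coord j) measurable_snd.
by under eq_fun do rewrite rV_cons0; exact: measurable_fst.
Qed.

End rV_measurable_fun.

Lemma sigma_finite_product d1 d2 (T1 : measurableType d1)
    (T2 : measurableType d2) (R : realType)
    (m1 : {sigma_finite_measure set T1 -> \bar R})
    (m2 : {sigma_finite_measure set T2 -> \bar R}) :
  sigma_finite setT (m1 \x m2)%E.
Proof.
have /sigma_finiteP[F [TF ndF Foo]] := sigma_finiteT m1.
have /sigma_finiteP[G [TG ndG Goo]] := sigma_finiteT m2.
exists (fun n => F n `*` G n).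
  rewrite -setXTT TF TG predeqE => -[x y]; split.
    move=> [/= [n _ Fnx] [k _ Gky]]; exists (maxn n k) => //; split.
    - by move: x Fnx; exact/subsetPset/ndF/leq_maxl.
    - by move: y Gky; exact/subsetPset/ndG/leq_maxr.
  by move=> [n _ []/= ? ?]; split; exists n.
move=> k; have [? ?] := Foo k; have [? ?] := Goo k.
split; first exact: measurableX.
by rewrite product_measure1E// lte_mul_pinfty// ge0_fin_numE.
Qed.

Section borel_lebesgue_step.
Context {R : realType} (n : nat).
Variable m : {sigma_finite_measure set 'rV[R]_n -> \bar R}.

Definition borel_lebesgue_step : set 'rV[R]_n.+1 -> \bar R :=
  pushforward (lebesgue_measure \x m)%E (@rV_cons R n).

Let step0 : borel_lebesgue_step set0 = 0%E.
Proof. by rewrite /borel_lebesgue_step /pushforward preimage_set0 measure0. Qed.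

Let step_ge0 A : (0 <= borel_lebesgue_step A)%E.
Proof. by rewrite /borel_lebesgue_step /pushforward; exact: measure_ge0. Qed.

Let step_sigma_additive : semi_sigma_additive borel_lebesgue_step.
Proof.
move=> F mF tF mUF; rewrite /borel_lebesgue_step /pushforward preimage_bigcup.
have mc A : measurable A -> measurable (@rV_cons R n @^-1` A).
  by move=> mA; rewrite -[X in measurable X]setTI; exact: measurable_rV_cons.
apply: measure_semi_sigma_additive => [k||]; first exact: mc.
  apply/trivIsetP => /= i j _ _ ij; rewrite -preimage_setI.
  by move/trivIsetP : tF => /(_ _ _ _ _ ij) ->//; rewrite preimage_set0.
by rewrite -preimage_bigcup; exact: mc.
Qed.

HB.instance Definition _ := isMeasure.Build _ _ _ borel_lebesgue_step
  step0 step_ge0 step_sigma_additive.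

Let step_sigma_finite : sigma_finite setT borel_lebesgue_step.
Proof.
have [S TS mS] : sigma_finite setT (lebesgue_measure \x m)%E.
  exact: sigma_finite_product.
exists (fun k => @rV_uncons R n @^-1` S k) => [|k].
  by rewrite -preimage_bigcup -TS preimage_setT.
have [mSk Sk_fin] := mS k; split.
  by rewrite -[X in measurable X]setTI; exact: measurable_rV_uncons.
rewrite /borel_lebesgue_step /pushforward -comp_preimage.
rewrite (_ : _ \o _ = id) ?preimage_id//.
by apply/funext => x /=; exact: rV_consK.
Qed.

HB.instance Definition _ := Measure_isSigmaFinite.Build _ _ _ borel_lebesgue_step
  step_sigma_finite.

End borel_lebesgue_step.

(* The n-fold product of the one-dimensional Lebesgue measure. *)
Fixpoint borel_lebesgue_rV (R : realType) n :
    {sigma_finite_measure set 'rV[R]_n -> \bar R} :=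
  if n is k.+1 then borel_lebesgue_step (borel_lebesgue_rV R k)
  else \d_(0 : 'rV[R]_0).

(* [Lebesgue_rV R n] is R^n equipped with the sigma-algebra of Lebesgue
   measurable sets (the completion of the Borel one), whereas ['rV[R]_n] itself
   carries the Borel sigma-algebra; the two types are convertible, so
   measurability statements must mention the intended one. *)
Definition Lebesgue_rV (R : realType) n :=
  caratheodory_type (borel_lebesgue_rV R n)^*%mu.
HB.instance Definition _ (R : realType) n := Measurable.on (Lebesgue_rV R n).

(* Likewise, R^n * R with the Lebesgue measurable subsets of R^(n + 1). *)
Definition Lebesgue_rV_R (R : realType) n :=
  caratheodory_type (borel_lebesgue_rV R n \x lebesgue_measure)%E^*%mu.
HB.instance Definition _ (R : realType) n := Measurable.on (Lebesgue_rV_R R n).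

Definition lebesgue_rV {R : realType} {n : nat} :
    set (Lebesgue_rV R n) -> \bar R :=
  @completed_measure_extension _ _ _ (borel_lebesgue_rV R n).
HB.instance Definition _ (R : realType) n := Measure.on (@lebesgue_rV R n).

Section euclidean.
Context {R : realType} {n : nat}.
Implicit Types (x : 'rV[R]_n) (r : R).

(* The norm of the library on ['rV[R]_n] is the sup norm. *)
Definition enorm x : R := Num.sqrt (\sum_(i < n) x 0 i ^+ 2).

Definition eball x r : set 'rV[R]_n := [set y | enorm (y - x) < r].

Definition closed_eball x r : set 'rV[R]_n := [set y | enorm (y - x) <= r].

End euclidean.

Section maximal_function.
Context {R : realType} {n : nat}.
Local Open Scope ereal_scope.

Definition hardy_littlewood (f : 'rV[R]_n -> R) (x : 'rV[R]_n) : \bar R :=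
  ereal_sup [set (lebesgue_rV (eball x r))^-1 *
                 \int[lebesgue_rV]_(y in eball x r) `|(f y)%:E|
            | r in [set r : R | (0 < r)%R]].

(* Extends phi by the convention phi(+oo) = +oo; it is only applied to
   nonnegative arguments, so the value at -oo is irrelevant. *)
Definition ext_at_infty (phi : R -> R) (y : \bar R) : \bar R :=
  if y is r%:E then (phi r)%:E else +oo.

(* Membership in L_Psi(B) only depends on the restriction of g to B. *)
Definition LPsi (Psi : 'rV[R]_n -> R -> R) (B : set 'rV[R]_n)
    : set ('rV[R]_n -> \bar R) :=
  [set g : 'rV[R]_n -> \bar R | measurable_fun (B : set (Lebesgue_rV R n)) g /\
    \int[lebesgue_rV]_(x in B) ext_at_infty (Psi x) `|g x| < +oo].

End maximal_function.

(* Main.v *)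
From HB Require Import structures.
Require Import Defs.
From mathcomp Require Import all_boot all_order all_algebra.
From mathcomp Require Import all_classical all_reals all_analysis.
From mathcomp Require Import measurable_realfun.
From mathcomp Require Import ring lra.
Set Implicit Arguments.
Unset Strict Implicit.
Unset Printing Implicit Defensive.
Import Order.TTheory GRing.Theory Num.Theory.
Import numFieldNormedType.Exports.
Local Open Scope classical_set_scope.
Local Open Scope ring_scope.

(* On the compact ball B every Psi x is comparable to the single function
   phi := Psi x1. With t_j := 2^j a and the increments
   D_j := phi t_{j+1} - phi t_j, doubling makes int_B Psi (M f) finite exactly
   when sum_j D_j |{x in B : M f > t_j}| is, and Abel summation makes
   |f| int_a^|f| psi_x(s) / s ds comparable, up to a multiple of |f|, to
   sum_j (D_j / t_j) |f| 1_{|f| > t_j}. The two sums are matched term by term by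
   the weak type inequality
     |{M f > l}| <= (C / l) int_{|f| > l / 2} |f|
   and, for large s, its converse
     int_{|f| > s} |f| <= C s |{x in B : M f > k s}|.
   Both follow from one Vitali covering lemma: if
   mu (Q(x, 3 r)) <= C nu (Q(x, r) n W) for suitable cubes around each x in E,
   then mu E <= C nu W; the same lemma combined with outer regularity gives
   |f| <= C M f almost everywhere, which the converse needs. *)

(** * Euclidean norm and balls *)

(** The library's [ball] is an open cube of the sup norm, whereas M f averages over Euclidean balls.
    Cubes carry the covering argument, because their volume (2 r)^n is explicit and inclusions are
    checked coordinate by coordinate. Passing from one shape to the other costs a factor n on the
    radius, which is the origin of the powers of n in the constants. The converse inequality is
    confined to large s because its cubes must stay smaller than B: only then does a fixed share of
    a cube centred in B lie inside B. The low levels are paid for by the integrability of f, which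
    follows from M f being finite at a single point of B. Neither Psi x (M f x) nor the weighted
    integrand is shown to be measurable in x. Each is compared pointwise with a measurable dyadic
    series, and the integrals are then compared as suprema over simple functions. *)

Section euclidean_norm.
Context {R : realType} {n : nat}.
Implicit Types (x y v w : 'rV[R]_n) (r s : R).

Lemma sqr_enorm v : enorm v ^+ 2 = \sum_(i < n) v 0 i ^+ 2.
Proof. by rewrite sqr_sqrtr// sumr_ge0// => i _; exact: sqr_ge0. Qed.

Lemma enorm_ge0 v : 0 <= enorm v.
Proof. exact: sqrtr_ge0. Qed.

Lemma coord_le_enorm v i : `|v 0 i| <= enorm v.
Proof.
rewrite -sqrtr_sqr ler_wsqrtr// (bigD1 i)//= lerDl.
by apply: sumr_ge0 => j _; exact: sqr_ge0.
Qed.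

Lemma enorm_eq0 v : enorm v = 0 -> v = 0.
Proof.
move=> v0; apply/rowP => i; rewrite mxE; apply/normr0_eq0/le_anti.
by rewrite normr_ge0 andbT -v0 coord_le_enorm.
Qed.

(** The crude factor n, instead of its square root, keeps the later constants polynomial in n. *)
Lemma enorm_le_coord v r : 0 <= r -> (forall i, `|v 0 i| <= r) ->
  enorm v <= n%:R * r.
Proof.
move=> r0 vr; rewrite -ler_sqr ?nnegrE ?enorm_ge0 ?mulr_ge0// sqr_enorm.
apply: (@le_trans _ _ (n%:R * r ^+ 2)).
  rewrite mulr_natl -[X in _ *+ X]card_ord -sumr_const ler_sum// => i _.
  by rewrite -real_normK ?num_real// ler_sqr ?nnegrE.
rewrite exprMn ler_wpM2r ?sqr_ge0// -natrX ler_nat.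
by case: n => // k; rewrite expnS expn1 leq_pmulr.
Qed.

Lemma enormZ r v : enorm (r *: v) = `|r| * enorm v.
Proof.
apply/(@pexpIrn _ 2); rewrite ?nnegrE ?mulr_ge0 ?enorm_ge0//.
rewrite exprMn !sqr_enorm real_normK ?num_real// mulr_sumr.
by apply: eq_bigr => i _; rewrite mxE exprMn.
Qed.

Lemma enorm0 : enorm (0 : 'rV[R]_n) = 0.
Proof. by rewrite -(scale0r (0 : 'rV_n)) enormZ normr0 mul0r. Qed.

Lemma enormN v : enorm (- v) = enorm v.
Proof. by rewrite -scaleN1r enormZ normrN1 mul1r. Qed.

Lemma enormB v w : enorm (v - w) = enorm (w - v).
Proof. by rewrite -enormN opprB. Qed.

Lemma cauchy_schwarz v w :
  \sum_(i < n) v 0 i * w 0 i <= enorm v * enorm w.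
Proof.
have [/enorm_eq0 ->|v0] := eqVneq (enorm v) 0.
  rewrite big1 ?mulr_ge0 ?enorm_ge0// => i _; by rewrite mxE mul0r.
have [/enorm_eq0 ->|w0] := eqVneq (enorm w) 0.
  rewrite big1 ?mulr_ge0 ?enorm_ge0// => i _; by rewrite mxE mulr0.
have vw : 0 < enorm v * enorm w by rewrite mulr_gt0// lt_neqAle eq_sym ?v0 ?w0 enorm_ge0.
rewrite -(ler_pM2l vw) -(ler_pM2l (ltr0n R 2)).
apply: (@le_trans _ _ (\sum_(i < n)
    (enorm w ^+ 2 * v 0 i ^+ 2 + enorm v ^+ 2 * w 0 i ^+ 2))).
  rewrite !mulr_sumr ler_sum// => i _.
  have := sqr_ge0 (enorm w * v 0 i - enorm v * w 0 i); lra.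
by rewrite big_split/= -!mulr_sumr -!sqr_enorm; lra.
Qed.

Lemma ler_enormD v w : enorm (v + w) <= enorm v + enorm w.
Proof.
rewrite -ler_sqr ?nnegrE ?addr_ge0 ?enorm_ge0// sqrrD !sqr_enorm.
have := cauchy_schwarz v w.
have -> : \sum_(i < n) (v + w) 0 i ^+ 2 = \sum_(i < n) v 0 i ^+ 2 +
    2 * \sum_(i < n) v 0 i * w 0 i + \sum_(i < n) w 0 i ^+ 2.
  rewrite mulr_sumr -!big_split/=; apply: eq_bigr => i _.
  by rewrite mxE; ring.
by rewrite -mulr_natl; lra.
Qed.

Lemma ler_enorm_sub x y z : enorm (x - z) <= enorm (x - y) + enorm (y - z).
Proof. by rewrite -[x - z](subrKA y) ler_enormD. Qed.

(** The positivity of r is a separate conjunct because the condition on the coordinates is vacuous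
    when n = 0. *)
Lemma rV_ballP x r y :
  ball x r y <-> 0 < r /\ forall i, `|x 0 i - y 0 i| < r.
Proof.
split=> [[r0 xy]|[r0 xy]]; first by split => // i; exact: xy.
by split => // i j; rewrite ord1; exact: xy.
Qed.

Lemma eball_sub_ball x r : eball x r `<=` ball x r.
Proof.
move=> y xy; apply/rV_ballP; split => [|i].
  exact: le_lt_trans (enorm_ge0 _) xy.
apply: le_lt_trans xy; rewrite -normrN opprB.
by have := coord_le_enorm (y - x) i; rewrite !mxE.
Qed.

Lemma closed_eball_sub_ball x r s : r < s -> closed_eball x r `<=` ball x s.
Proof. by move=> rs y xy; apply: eball_sub_ball; exact: le_lt_trans xy rs. Qed.

Lemma ball_sub_closed_eball x r : ball x r `<=` closed_eball x (n%:R * r).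
Proof.
move=> y /rV_ballP[r0 xy]; apply: enorm_le_coord; first exact: ltW.
by move=> i; rewrite !mxE -normrN opprB ltW.
Qed.

Lemma ball_sub_eball x r s : n%:R * r < s -> ball x r `<=` eball x s.
Proof. by move=> rs y /ball_sub_closed_eball; rewrite /closed_eball/= => /le_lt_trans; exact. Qed.

Lemma open_eball x r : open (eball x r).
Proof.
rewrite openE => y /= xy; apply/nbhs_ballP.
(* Dividing by n + 1 instead of n makes n e strictly smaller than the gap, and keeps e meaningful
   when n = 0. *)
pose e := (r - enorm (y - x)) / n.+1%:R.
have e0 : 0 < e by rewrite divr_gt0// subr_gt0.
exists e => //= z /ball_sub_closed_eball; rewrite /closed_eball /eball/= => yz.
rewrite (le_lt_trans (ler_enorm_sub z y x))// -ltrBrDr (le_lt_trans yz)//.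
rewrite /e mulrA ltr_pdivrMr// mulrC ltr_pM2l ?subr_gt0//.
by rewrite ltr_nat.
Qed.

Lemma compact_closed_eball x r : compact (closed_eball x r).
Proof.
apply: bounded_closed_compact.
  exists (enorm x + r); split; first exact: num_real.
  move=> s rs y xy; rewrite /= [leLHS]/Num.norm/= mx_normrE.
  have e0 : 0 <= s.
    have := le_trans (enorm_ge0 _) xy; have := enorm_ge0 x; lra.
  apply/bigmax_leP; split => //= -[i j] _ /=; rewrite ord1.
  rewrite (le_trans (coord_le_enorm _ _))// (le_trans _ (ltW rs))//.
  by rewrite -[y](subrK x) (le_trans (ler_enormD _ _))// addrC lerD2l.
rewrite -[X in closed X]setCK closedC openE => y /= /negP; rewrite -ltNge => xy.
apply/nbhs_ballP; pose e := (enorm (y - x) - r) / n.+1%:R.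
have e0 : 0 < e by rewrite divr_gt0// subr_gt0.
exists e => //= z /ball_sub_closed_eball; rewrite /closed_eball/= => yz.
apply/negP; rewrite -ltNge.
have : n%:R * e < enorm (y - x) - r.
  rewrite /e mulrA ltr_pdivrMr// mulrC ltr_pM2l ?subr_gt0//.
  by rewrite ltr_nat.
have := ler_enorm_sub y z x; rewrite (enormB y z); lra.
Qed.

End euclidean_norm.

(** * Lebesgue measure on R^n *)

Section borel_rV.
Context {R : realType}.

Lemma measurable_ball_rV n (x : 'rV[R]_n) r :
  measurable (ball x r : set 'rV[R]_n).
Proof.
have [r0|r0] := ltP 0 r; last first.
  rewrite (_ : ball x r = set0); first exact: measurable0.
  by apply/seteqP; split => // y /rV_ballP[/lt_le_trans/(_ r0)]; rewrite ltxx.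
have -> : ball x r = \bigcap_(i in [set: 'I_n])
    ((fun y : 'rV[R]_n => y 0 i : measurableTypeR R) @^-1` ball (x 0 i) r).
  apply/seteqP; split => [y /rV_ballP[_ xy] i _|y xy]; first exact: xy.
  by apply/rV_ballP; split => // i; exact: xy.
apply: fin_bigcap_measurable => // i _; rewrite -[X in measurable X]setTI.
by apply: measurable_coord => //; exact: measurable_ball.
Qed.

Lemma borel_lebesgue_ball n (x : 'rV[R]_n) r : 0 < r ->
  borel_lebesgue_rV R n (ball x r) = ((2 * r) ^+ n)%:E.
Proof.
move=> r0; elim: n x => [|n IH] x.
  rewrite /= diracE mem_set ?expr0//.
  by apply/rV_ballP; split => // -[].
rewrite /= /borel_lebesgue_step /pushforward.
have -> : @rV_cons R n @^-1` ball x r =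
    (ball (x 0 ord0) r `*` ball (\row_j x 0 (lift ord0 j)) r).
  apply/seteqP; split => [p /rV_ballP[_ xp]|p [/= p1 /rV_ballP[_ p2]]].
    split => /=; first by have := xp ord0; rewrite rV_cons0.
    by apply/rV_ballP; split => // i; have := xp (lift ord0 i); rewrite rV_consS mxE.
  apply/rV_ballP; split => // i; case: (unliftP ord0 i) => [j|] ->.
    by rewrite rV_consS; have := p2 j; rewrite mxE.
  by rewrite rV_cons0.
rewrite product_measure1E; last 2 first.
- exact: measurable_ball.
- exact: measurable_ball_rV.
rewrite [X in (_ * X)%E]IH [X in (X * _)%E](lebesgue_measure_ball _ (ltW r0)).
by rewrite -EFinM exprS mulr_natl.
Qed.

Definition rat_ball n (p : 'rV[rat]_n * rat) : set 'rV[R]_n :=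
  ball (\row_i ratr (p.1 0 i) : 'rV[R]_n) (ratr p.2).

Lemma rational_ball n (U : set 'rV[R]_n) x : open U -> U x ->
  exists p : 'rV[rat]_n * rat,
    rat_ball p x /\ rat_ball p `<=` U.
Proof.
rewrite openE => oU /oU /nbhs_ballP[e /= e0 xeU].
have [q] := @rat_in_itvoo R 0 (e / 2) (divr_gt0 e0 (ltr0n _ 2)).
rewrite in_itv/= => /andP[q0 qe].
have H i : exists s : rat, `|ratr s - x 0 i| < ratr q :> R.
  have [|s] := @rat_in_itvoo R (x 0 i - ratr q) (x 0 i + ratr q); first by lra.
  by rewrite in_itv/= => xs; exists s; rewrite ltr_distl.
have [s sx] := choice H.
exists (\row_i s i, q) => /=; split.
  by apply/rV_ballP; split => // i; rewrite !mxE.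
move=> y /rV_ballP[_ sy]; apply: xeU; apply/rV_ballP; split => // i.
have := sy i; rewrite !mxE => {}sy; have := sx i; rewrite distrC => {}sx.
by rewrite (le_lt_trans (ler_distD (ratr (s i)) _ _))//; lra.
Qed.

Lemma open_measurable_rV n (U : set 'rV[R]_n) :
  open U -> measurable (U : set 'rV[R]_n).
Proof.
move=> oU; have -> : U = \bigcup_(p in [set p : 'rV[rat]_n * rat |
    rat_ball p `<=` U])
    rat_ball p.
  apply/seteqP; split => [x Ux|x [p /= pU] /pU//].
  by have [p [px pU]] := rational_ball oU Ux; exists p.
rewrite bigcup_mkcond; apply: countable_bigcupT_measurable => // p.
by case: ifPn => _; [exact: measurable_ball_rV|exact: measurable0].
Qed.

(** Each x in E lies in a rational cube contained in its own cube. There are countably many rational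
    cubes; each that arises in this way selects one point of E, and indices that select nothing
    return the default point [x0]. *)
Lemma lindelof_ball n (E : set 'rV[R]_n) (rad : 'rV[R]_n -> R) :
  E !=set0 -> (forall x, E x -> 0 < rad x) ->
  exists z : nat -> 'rV[R]_n,
    (forall k, E (z k)) /\ E `<=` \bigcup_k ball (z k) (rad (z k)).
Proof.
move=> [x0 Ex0] rad0.
pose S (p : 'rV[rat]_n * rat) := [set x | E x /\
  rat_ball p `<=` ball x (rad x)].
pose c (p : option ('rV[rat]_n * rat)) :=
  if p is Some p then xget x0 (S p) else x0.
exists (fun k => c (unpickle k)); split => [k|x Ex].
  by rewrite /c; case: unpickle => // p; case: xgetP => // y _ [].
have ob : open (ball x (rad x)) by apply: ball_open; exact: rad0.
have [p [px pE]] := rational_ball ob (ballxx x (rad0 _ Ex)).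
exists (pickle p) => //; rewrite pickleK /=.
by case: xgetP => [y _ [_]|/(_ x)[]//]; exact.
Qed.

End borel_rV.

Section lebesgue_rV.
Context {R : realType} {n : nat}.
Notation mu := (@lebesgue_rV R n).

Lemma measurable_lebesgue_rV (A : set 'rV[R]_n) :
  measurable (A : set 'rV[R]_n) -> measurable (A : set (Lebesgue_rV R n)).
Proof. by move=> mA; exact: caratheodory_measurable_mu_ext. Qed.

Lemma lebesgue_rVE (A : set 'rV[R]_n) : measurable (A : set 'rV[R]_n) ->
  mu A = borel_lebesgue_rV R n A.
Proof.
by move=> mA; rewrite /lebesgue_rV/= /completed_measure_extension measurable_mu_extE.
Qed.

Lemma open_lebesgue_measurable (U : set 'rV[R]_n) :
  open U -> measurable (U : set (Lebesgue_rV R n)).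
Proof. by move=> oU; apply: measurable_lebesgue_rV; exact: open_measurable_rV. Qed.

Lemma measurable_ball_lebesgue (x : 'rV[R]_n) r :
  measurable (ball x r : set (Lebesgue_rV R n)).
Proof. by apply: measurable_lebesgue_rV; exact: measurable_ball_rV. Qed.

Lemma lebesgue_ball (x : 'rV[R]_n) r : 0 < r ->
  mu (ball x r) = ((2 * r) ^+ n)%:E.
Proof.
by move=> r0; rewrite lebesgue_rVE ?borel_lebesgue_ball//; exact: measurable_ball_rV.
Qed.

End lebesgue_rV.

Section continuity_of_measures.
Context d (T : measurableType d) (R : realType).
Variable mu : {measure set T -> \bar R}.
Local Open Scope ereal_scope.

Lemma nonincreasing_measure_lt (F : (set T)^nat) (a : \bar R) :
  (forall k, measurable (F k)) -> nonincreasing_seq F -> mu (F 0%N) < +oo ->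
  mu (\bigcap_k F k) < a -> exists k, mu (F k) < a.
Proof.
move=> mF ndF F0 Fa.
have /(_ _ (open_ereal_lt' Fa)) := nonincreasing_cvg_mu F0 mF
  (bigcapT_measurable mF) ndF.
by move=> [N _ HN]; exists N; exact: HN (leqnn N).
Qed.

Lemma nondecreasing_measure_gt (F : (set T)^nat) (a : \bar R) :
  (forall k, measurable (F k)) -> nondecreasing_seq F ->
  a < mu (\bigcup_k F k) -> exists k, a < mu (F k).
Proof.
move=> mF ndF Fa.
have : mu \o F @ \oo --> mu (\bigcup_k F k).
  by apply: nondecreasing_cvg_mu => //; exact: bigcupT_measurable.
move=> /(_ _ (open_ereal_gt' Fa)).
by move=> [N _ HN]; exists N; exact: HN (leqnn N).
Qed.

Lemma nondecreasing_measure_le (F : (set T)^nat) (a : \bar R) :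
  (forall k, measurable (F k)) -> nondecreasing_seq F ->
  (forall k, mu (F k) <= a) -> mu (\bigcup_k F k) <= a.
Proof.
move=> mF ndF Fa; rewrite leNgt; apply/negP => /(nondecreasing_measure_gt mF ndF).
by move=> [k]; rewrite ltNge Fa.
Qed.

End continuity_of_measures.

(** * Outer regularity of finite Borel measures, then of Lebesgue measure *)

Section regularity.
Context {R : realType} {n : nat}.
Variable nu : {measure set 'rV[R]_n -> \bar R}.
Hypothesis nu_fin : (nu setT < +oo)%E.

Let closed_measurable (F : set 'rV[R]_n) :
  closed F -> measurable (F : set 'rV[R]_n).
Proof.
by move=> cF; rewrite -[F]setCK; apply: measurableC; apply: open_measurable_rV; exact: closed_openC.
Qed.

Let nu_lt (A : set 'rV[R]_n) :
  measurable (A : set 'rV[R]_n) -> (nu A < +oo)%E.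
Proof. by move=> mA; apply: le_lt_trans nu_fin; rewrite le_measure ?inE. Qed.

(** Asking for an open set outside and a closed set inside at once makes the property symmetric
    under complement, so that the regular sets form a sigma-algebra; it then suffices to treat
    closed half-spaces. *)
Let regular (A : set 'rV[R]_n) := forall e : R, 0 < e ->
  exists U F, [/\ open U, closed F, F `<=` A, A `<=` U & (nu (U `\` F) < e%:E)%E].

Let regularC A : regular A -> regular (setT `\` A).
Proof.
move=> rA e /rA[U [F [oU cF FA AU UF]]]; exists (~` F), (~` U); split.
- exact: closed_openC.
- exact: open_closedC.
- by move=> x Ux; split => // /AU.
- by move=> x [_ nAx] /FA.
- by rewrite setDE setCK setIC -setDE.
Qed.

Let regular_bigcup (A : (set 'rV[R]_n)^nat) :
  (forall k, regular (A k)) -> regular (\bigcup_k A k).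
Proof.
move=> rA e e0.
have /choice[U /choice[F UF]] k : exists U F, [/\ open U, closed F,
    F `<=` A k, A k `<=` U & (nu (U `\` F) < (e / 2 / (2 ^ k.+1)%:R)%:E)%E].
  by apply: rA; rewrite !divr_gt0// ltr0n expn_gt0.
(* A countable union of closed sets need not be closed, so only finitely many are kept; continuity
   from above of the finite measure [nu] shows that enough of them leave an error below e. *)
pose C k := \big[setU/set0]_(i < k) F i.
have cC k : closed (C k).
  by apply: closed_bigsetU => i _; have [] := UF i.
have oU : open (\bigcup_k U k) by apply: bigcup_open => k _; have [] := UF k.
have mD k : measurable (U k `\` F k : set 'rV[R]_n).
  have [oUk cFk _ _ _] := UF k.
  by apply: measurableD; [exact: open_measurable_rV|exact: closed_measurable].
have mUC k : measurable (\bigcup_k U k `\` C k : set 'rV[R]_n).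
  by apply: measurableD; [exact: open_measurable_rV|exact: closed_measurable].
have [k UCk] : exists k, (nu (\bigcup_k U k `\` C k) < e%:E)%E.
  apply: nonincreasing_measure_lt => //.
  - move=> i j ij; apply/subsetPset; apply: setDS.
    by rewrite /C -!bigcup_mkord => x [m /= mi Fm]; exists m => //=; exact: leq_trans ij.
  - exact: nu_lt.
  apply: (@le_lt_trans _ _ (\sum_(k <oo) nu (U k `\` F k))%E).
    apply: measure_sigma_subadditive => //.
      exact: bigcapT_measurable.
    move=> x Hx; have [[k _ Ukx] _] := Hx 0%N Logic.I.
    exists k => //; split => // Fkx; have [_] := Hx k.+1 Logic.I; apply.
    by rewrite /C -bigcup_mkord; exists k => /=.
  apply: (@le_lt_trans _ _ (e / 2)%:E); last by rewrite lte_fin; lra.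
  apply: le_trans (epsilon_trick0 xpredT _); last by rewrite divr_ge0// ltW.
  by apply: lee_nneseries => // k _; apply: ltW; have [] := UF k.
exists (\bigcup_k U k), (C k); split => //.
- rewrite /C -bigcup_mkord => x [i /= _ Fi]; exists i => //.
  by have [_ _ + _ _] := UF i; exact.
- by move=> x [i _ Ai]; exists i => //; have [_ _ _ + _] := UF i; exact.
Qed.

Let regular_ray (i : 'I_n) x :
  regular ((fun y : 'rV[R]_n => y 0 i) @^-1` `[x, +oo[).
Proof.
move=> e e0; pose U k := (fun y : 'rV[R]_n => y 0 i) @^-1` `]x - k.+1%:R^-1, +oo[.
set F := _ @^-1` _.
have oU k : open (U k).
  apply: open_comp; last exact: interval_open.
  by move=> y _; exact: coord_continuous.
have cF : closed F.
  apply: preimage_closed; last exact: interval_closed.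
  by move=> y _; exact: coord_continuous.
have [k UFk] : exists k, (nu (U k `\` F) < e%:E)%E.
  have mUF k : measurable (U k `\` F : set 'rV[R]_n).
    by apply: measurableD; [exact: open_measurable_rV|exact: closed_measurable].
  apply: nonincreasing_measure_lt => //.
  - move=> j k jk; apply/subsetPset; apply: setSD => y.
    rewrite /U /= !in_itv/= !andbT; apply: le_lt_trans; rewrite lerD2l lerN2.
    by rewrite lef_pV2 ?posrE// ler_nat.
  - exact: nu_lt.
  rewrite (_ : \bigcap_k _ = set0) ?measure0 ?lte_fin//.
  apply/seteqP; split => // y Hy; have [_] := Hy 0%N Logic.I; apply.
  rewrite /F/= in_itv/= andbT leNgt; apply/negP => yx.
  have [k /=] := ltr_add_invr yx; rewrite -ltrBrDr => yk.
  have [+ _] := Hy k Logic.I; rewrite /U/= in_itv/= andbT ltNge => /negP; apply.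
  exact: ltW.
exists (U k), F; split => // y; rewrite /F /U/= !in_itv/= !andbT.
by apply: lt_le_trans; rewrite ltrBlDr ltrDl invr_gt0.
Qed.

Lemma finite_measure_outer_regular (A : set 'rV[R]_n) (e : R) :
  measurable (A : set 'rV[R]_n) -> 0 < e ->
  exists U, [/\ open U, A `<=` U & (nu U <= nu A + e%:E)%E].
Proof.
move=> mA e0.
have r0 : regular set0.
  move=> e1 e10; exists set0, set0; split => //; do ?[exact: open0|exact: closed0].
  by rewrite setD0 measure0 lte_fin.
have : regular A.
  move: A mA; apply: smallest_sub; first by split.
  rewrite -bigcup_seq/= => _ [i _ [Y mY <-]]; rewrite setTI.
  rewrite /= in mY.
  have : (@RGenCInfty.G R).-sigma.-measurable Y by rewrite -RGenCInfty.measurableE.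
  move: Y {mY}; apply: smallest_sub; last first.
    by move=> _ [x ->]; exact: regular_ray.
  split; first by rewrite /= preimage_set0.
  - by move=> Y rY; rewrite /= setTD preimage_setC -setTD; exact: regularC.
  - by move=> Y rY; rewrite /= preimage_bigcup; exact: regular_bigcup.
move=> /(_ _ e0)[U [F [oU cF FA AU UF]]]; exists U; split => //.
have mU := open_measurable_rV oU; have mF := closed_measurable cF.
rewrite -(setDUK (subset_trans FA AU)) measureU//; last 2 first.
- exact: measurableD.
- by rewrite setDE setICA setICr setI0.
by rewrite leeD ?(ltW UF)// le_measure ?inE.
Qed.

End regularity.

Lemma lebesgue_outer_regular (R : realType) n (E : set (Lebesgue_rV R n))
    (x : 'rV[R]_n) r (e : R) :
  measurable E -> E `<=` ball x r -> 0 < e ->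
  exists U : set 'rV[R]_n, [/\ open U, E `<=` U &
    (lebesgue_rV (U : set (Lebesgue_rV R n)) <= lebesgue_rV E + e%:E)%E].
Proof.
move=> mE Exr e0.
have [->|/set0P[y Ey]] := eqVneq E set0; first by
  exists set0; split; [exact: open0|by []|rewrite !measure0 add0e lee_fin ltW].
have /rV_ballP[r0 _] := Exr _ Ey.
have mB := measurable_ball_rV x r.
have e20 : 0 < e / 2 by rewrite divr_gt0.
have fE : (lebesgue_rV E < +oo)%E.
  apply: (@le_lt_trans _ _ (lebesgue_rV (ball x r : set (Lebesgue_rV R n)))).
    by rewrite le_measure ?inE//; exact: measurable_ball_lebesgue.
  by rewrite lebesgue_ball ?ltry.
have : (lebesgue_rV E < lebesgue_rV E + (e / 2)%:E)%E.
  by rewrite lteDl ?lte_fin// ge0_fin_numE.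
(* [lebesgue_rV E] unfolds to the outer measure, an infimum over countable Borel covers: half of e
   is spent here, the other half on the open set. *)
move=> /ereal_inf_lt[_ [A [mA EA] <-] EAe].
pose B := \bigcup_k A k `&` ball x r.
have mB' : measurable (B : set 'rV[R]_n).
  by apply: measurableI => //; exact: bigcupT_measurable.
(* Lebesgue measure is restricted to the cube to become a finite measure. *)
pose nu := mrestr (borel_lebesgue_rV R n) mB.
have nufin : (nu setT < +oo)%E.
  by rewrite /nu /mrestr setTI borel_lebesgue_ball ?ltry.
have [U [oU BU UB]] := finite_measure_outer_regular nufin mB' e20.
exists (U `&` ball x r); split.
- by apply: openI => //; exact: ball_open.
- by move=> z Ez; split; [apply: BU; split; [exact: EA|exact: Exr]|exact: Exr].
rewrite lebesgue_rVE; last by apply: measurableI => //; exact: open_measurable_rV.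
apply: (le_trans UB); rewrite [e in leRHS](splitr e) EFinD addeA leeD2r//.
apply: le_trans (ltW EAe); rewrite /nu /mrestr.
by apply: measure_sigma_subadditive => //; [exact: measurableI|move=> z [[]]].
Qed.

(** * Covering lemma *)

Lemma exists_max_seq (R : realDomainType) (T : eqType) (f : T -> R) (x : T) s :
  exists2 m, m \in x :: s & forall y, y \in x :: s -> f y <= f m.
Proof.
elim: s => [|y s IH] in x *.
  by exists x; rewrite ?mem_head// => y; rewrite inE => /eqP ->.
have [m ms fm] := IH y; have [xm|mx] := leP (f x) (f m).
  exists m; first by rewrite in_cons ms orbT.
  by move=> z; rewrite in_cons => /predU1P[->//|/fm].
exists x; first by rewrite mem_head.
move=> z; rewrite in_cons => /predU1P[->//|/fm /le_trans]; apply; exact: ltW.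
Qed.

Section covering.
Context {R : realType} {n : nat}.
Variables mu nu : {measure set (Lebesgue_rV R n) -> \bar R}.
Variables (W : set (Lebesgue_rV R n)) (C : R) (rad : 'rV[R]_n -> R).
Hypotheses (mW : measurable W) (C0 : 0 <= C).
Local Open Scope ereal_scope.

Let B x : set (Lebesgue_rV R n) := ball (x : 'rV[R]_n) (rad x).

Let controlled (x : 'rV[R]_n) := (0 < rad x)%R /\
  mu (ball x (3 * rad x)%R) <= C%:E * nu (B x `&` W).

Let measurable_bigB (s : seq 'rV[R]_n) : measurable (\bigcup_(x in [set` s]) B x).
Proof. by apply: fin_bigcup_measurable => // x _; exact: measurable_ball_lebesgue. Qed.

(* Vitali's greedy selection: peel off a ball of maximal radius together with
   the balls meeting it, all of which lie in its threefold enlargement. *)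
Let finite_covering (s : seq 'rV[R]_n) : (forall x, x \in s -> controlled x) ->
  mu (\bigcup_(x in [set` s]) B x) <= C%:E * nu (\bigcup_(x in [set` s]) B x `&` W).
Proof.
have [k] := ubnP (size s); elim: k => // k IH in s *; case: s => [_ _|x0 s0].
  by rewrite set_nil bigcup_set0 measure0 set0I measure0 mule0.
move=> sk sctr; have [m ms mmax] := exists_max_seq rad x0 s0.
move: (x0 :: s0) sk sctr ms mmax => {x0 s0} s; rewrite ltnS => sk sctr ms mmax.
pose disj x := `[< B x `&` B m = set0 >]; pose s' := [seq x <- s | disj x].
have [m0 mC] := sctr _ ms.
have Bm : B m m by exact: ballxx.
have s's : (size s' < size s)%N.
  rewrite size_filter -(count_predC disj) -[X in (X < _)%N]addn0 ltn_add2l -has_count.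
  by apply/hasP; exists m => //=; apply/asboolP => /seteqP[/(_ m) + _]; move/(_ (conj Bm Bm)).
have := IH s' (leq_trans s's sk) _.
have sub : \bigcup_(x in [set` s]) B x `<=`
    (ball m (3 * rad m)%R : set (Lebesgue_rV R n)) `|` \bigcup_(x in [set` s']) B x.
  move=> y [x /= xs xy]; have [d|d] := boolP (disj x).
    by right; exists x => //=; rewrite mem_filter d.
  left; move/asboolP : d => /eqP/set0P[z [xz mz]].
  have xm := mmax _ xs.
  apply/rV_ballP; split; first by rewrite mulr_gt0.
  move=> i; move: xy xz mz => /rV_ballP[_ /(_ i) +] /rV_ballP[_ /(_ i) +] /rV_ballP[_ /(_ i) +].
  have := ler_distD (z 0%R i) (m 0%R i) (y 0%R i).
  have := ler_distD (x 0%R i) (z 0%R i) (y 0%R i).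
  rewrite [`|z _ _ - x _ _|%R]distrC.
  lra.
have mB3 : measurable (ball m (3 * rad m)%R : set (Lebesgue_rV R n)).
  exact: measurable_ball_lebesgue.
move=> IHs'.
apply: (@le_trans _ _ (mu (ball m (3 * rad m)%R) + mu (\bigcup_(x in [set` s']) B x))).
  apply: (le_trans _ (measureU2 _ _ _)) => //.
  by rewrite le_measure ?inE//; exact: measurableU.
apply: (@le_trans _ _ (C%:E * nu (B m `&` W) +
    C%:E * nu (\bigcup_(x in [set` s']) B x `&` W))).
  rewrite leeD// IHs'// => x; rewrite mem_filter => /andP[_]; exact: sctr.
have mBm : measurable (B m) by exact: measurable_ball_lebesgue.
rewrite -ge0_muleDr// lee_wpmul2l// -measureU//; last 3 first.
- exact: measurableI.
- by apply: measurableI.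
- apply/seteqP; split => // y [[my _] [[x /=]]].
  by rewrite mem_filter => /andP[/asboolP /seteqP[/(_ y) + _] _] xy _; move/(_ (conj xy my)).
rewrite le_measure ?inE//.
- by apply: measurableU; exact: measurableI.
- exact: measurableI.
- move=> y [[my Wy]|[[x /=]]]; first by split => //; exists m.
  by rewrite mem_filter => /andP[_ xs] xy Wy; split => //; exists x.
Qed.

(** The radii may be unbounded: Lindelöf leaves countably many cubes, the greedy selection is run on
    the first k of them with a constant independent of k, and k tends to infinity. *)
Lemma covering (E : set (Lebesgue_rV R n)) : measurable E ->
  (forall x, E x -> controlled x) -> mu E <= C%:E * nu W.
Proof.
move=> mE Ectr; have [->|/set0P E0] := eqVneq E set0.
  by rewrite measure0 mule_ge0.
have [z [Ez Ecov]] := @lindelof_ball _ _ E rad E0 (fun x Ex => (Ectr x Ex).1).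
pose F k := \bigcup_(x in [set` map z (iota 0 k)]) B x.
have ndF : nondecreasing_seq F.
  move=> i j ij; apply/subsetPset => y [x /= /mapP[k +] ->]; rewrite mem_iota/= => ki ky.
  by exists (z k) => //=; apply: map_f; rewrite mem_iota/= (leq_trans ki).
apply: (@le_trans _ _ (mu (\bigcup_k F k))).
  rewrite le_measure ?inE//; first by apply: bigcupT_measurable => k; exact: measurable_bigB.
  move=> x /Ecov[k _ xk]; exists k.+1 => //; exists (z k) => //.
    by apply: (map_f z); rewrite mem_iota/= add0n ltnSn.
apply: nondecreasing_measure_le => // k; first exact: measurable_bigB.
apply: (@le_trans _ _ (C%:E * nu (F k `&` W))).
  by apply: finite_covering => x /mapP[j _ ->]; exact: Ectr.
rewrite lee_wpmul2l// le_measure ?inE//.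
by apply: measurableI => //; exact: measurable_bigB.
Qed.

End covering.

(** * Weak type inequality and its converse *)

Section abs_density.
Context d (T : measurableType d) (R : realType).
Variables (mu : {measure set T -> \bar R}) (f : T -> R).
Hypothesis mf : measurable_fun setT f.
Local Open Scope ereal_scope.

(** The anonymous argument keeps the measurability of f inside the term, where the measure instance
    below can find it. *)
Definition abs_density & measurable_fun setT f := fun A : set T =>
  \int[mu]_(x in A) `|(f x)%:E|.

Lemma measurable_abs_density (D : set T) :
  measurable D -> measurable_fun D (fun x => `|(f x)%:E|).
Proof.
move=> mD; apply: measurableT_comp => //; apply/measurable_EFinP.
exact: measurable_funS mf.
Qed.

Lemma measurable_abs_gt (l : R) : measurable [set x | (l < `|f x|)%R].
Proof.
have mabs : measurable_fun setT (fun x => `|f x|%R) by exact: measurableT_comp.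
rewrite (_ : [set x | _] = (fun x => `|f x|%R) @^-1` `]l, +oo[).
  by rewrite -[X in measurable X]setTI; exact: mabs.
by apply/seteqP; split => x /=; rewrite in_itv/= andbT.
Qed.

Let density0 : abs_density mf set0 = 0.
Proof. exact: integral_set0. Qed.

Let density_ge0 A : 0 <= abs_density mf A.
Proof. exact: integral_ge0. Qed.

Let density_sigma_additive : semi_sigma_additive (abs_density mf).
Proof.
move=> F mF tF mUF; rewrite /abs_density ge0_integral_bigcup//.
  by apply: is_cvg_nneseries => k _ _; exact: integral_ge0.
exact: measurable_abs_density.
Qed.

HB.instance Definition _ := isMeasure.Build _ _ _ (abs_density mf)
  density0 density_ge0 density_sigma_additive.

End abs_density.

(** The weak type inequality takes [mu] to be Lebesgue measure and [nu] the measure with density |f|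
    cut off at small values. The differentiation lemma and the converse inequality exchange the
    roles: [mu] has density |f| and [nu] is Lebesgue measure. *)
Lemma covering_ex (R : realType) n
    (mu nu : {measure set (Lebesgue_rV R n) -> \bar R})
    (W E : set (Lebesgue_rV R n)) (C : R) :
  measurable W -> 0 <= C -> measurable E ->
  (forall x : 'rV[R]_n, E x -> exists r, 0 < r /\
    (mu (ball x (3 * r)) <= C%:E * nu (ball x r `&` W))%E) ->
  (mu E <= C%:E * nu W)%E.
Proof.
move=> mW C0 mE H; pose S (x : 'rV[R]_n) := [set r : R | 0 < r /\
    (mu (ball x (3 * r)) <= C%:E * nu (ball x r `&` W))%E].
apply: (@covering _ _ mu nu W C (fun x => xget 1 (S x))) => // x /H[r Hr].
by case: xgetP => [_ _ //|/(_ r)].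
Qed.

Section hardy_littlewood_bounds.
Context {R : realType} {n : nat} (n_gt0 : (0 < n)%N).
Notation T := (Lebesgue_rV R n).
Notation mu := (@lebesgue_rV R n).
Notation N := (n%:R : R).
Variable f : 'rV[R]_n -> R.
Hypothesis mf : measurable_fun [set: T] (f : T -> R).
Local Open Scope ereal_scope.
Notation M := (hardy_littlewood f).
Notation I := (abs_density mu mf).

Let N0 : (0 < N)%R. Proof. by rewrite ltr0n. Qed.

Lemma measurable_eball (x : 'rV[R]_n) r : measurable (eball x r : set T).
Proof. by apply: open_lebesgue_measurable; exact: open_eball. Qed.

Lemma measurable_closed_eball (x : 'rV[R]_n) r : measurable (closed_eball x r : set T).
Proof.
rewrite -[closed_eball x r]setCK; apply: measurableC; apply: open_lebesgue_measurable.
apply: closed_openC; apply: compact_closed; last exact: compact_closed_eball.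
exact: norm_hausdorff.
Qed.

Lemma lebesgue_eball_le (x : 'rV[R]_n) r : (0 < r)%R ->
  mu (eball x r) <= ((2 * r) ^+ n)%:E.
Proof.
move=> r0; rewrite -(lebesgue_ball x)// le_measure ?inE//.
- exact: measurable_eball.
- exact: measurable_ball_lebesgue.
- exact: eball_sub_ball.
Qed.

Lemma lebesgue_eball_ge (x : 'rV[R]_n) r : (0 < r)%R ->
  ((r / N) ^+ n)%:E <= mu (eball x r).
Proof.
move=> r0; have r2 : (0 < r / (2 * N))%R by rewrite divr_gt0// mulr_gt0.
have -> : (r / N = 2 * (r / (2 * N)))%R by field; rewrite gt_eqF.
rewrite -(lebesgue_ball x)// le_measure ?inE//.
- exact: measurable_ball_lebesgue.
- exact: measurable_eball.
- apply: ball_sub_eball.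
  have -> : (N * (r / (2 * N)) = r / 2)%R by field; rewrite gt_eqF.
  by rewrite ltr_pdivrMr// ltr_pMr// ltr1n.
Qed.

Lemma lebesgue_eball_fin (x : 'rV[R]_n) r : (0 < r)%R ->
  exists2 v : R, (0 < v)%R & mu (eball x r) = v%:E.
Proof.
move=> r0; have vf : mu (eball x r) \is a fin_num.
  by rewrite ge0_fin_numE// (le_lt_trans (lebesgue_eball_le x r0)) ?ltry.
exists (fine (mu (eball x r))); last by rewrite fineK.
rewrite -lte_fin fineK//; apply: lt_le_trans (lebesgue_eball_ge x r0).
by rewrite lte_fin exprn_gt0// divr_gt0.
Qed.

Lemma hardy_littlewood_gtP (x : 'rV[R]_n) (l : R) :
  l%:E < M x <-> exists r : R, (0 < r)%R /\ l%:E * mu (eball x r) < I (eball x r).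
Proof.
have E r : (0 < r)%R -> (l%:E * mu (eball x r) < I (eball x r)) =
    (l%:E < (mu (eball x r))^-1 * I (eball x r)).
  move=> r0; have [v v0 ->] := lebesgue_eball_fin x r0.
  by rewrite inver gt_eqF// lte_pdivlMl// muleC.
split=> [/ereal_sup_gt[_ [r r0 <-] lr]|[r [r0 lr]]].
  by exists r; split => //; rewrite E.
rewrite E// in lr; apply: (lt_le_trans lr); apply: ereal_sup_ubound.
by exists r.
Qed.

Lemma hardy_littlewood_leP (x : 'rV[R]_n) (l r : R) : M x <= l%:E -> (0 < r)%R ->
  I (eball x r) <= l%:E * mu (eball x r).
Proof.
move=> Ml r0; rewrite leNgt; apply/negP => lr.
by move: Ml; rewrite leNgt => /negP; apply; apply/hardy_littlewood_gtP; exists r.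
Qed.

Lemma hardy_littlewood_ge0 (x : 'rV[R]_n) : 0 <= M x.
Proof.
have [v v0 vE] := lebesgue_eball_fin x ltr01.
apply: le_ereal_sup_tmp; exists ((mu (eball x 1))^-1 * I (eball x 1)).
  by exists 1%R => //=; rewrite ltr01.
by rewrite vE inver gt_eqF// mule_ge0// lee_fin invr_ge0 ltW.
Qed.

(** Lower semicontinuity of M f. By continuity from below, the integral over a ball of radius r - e
    around x still exceeds l times the volume of the ball of radius r. For y within e / 2 of x, the
    ball of radius r - e / 2 around y is nested between these two. *)
Lemma open_hardy_littlewood_gt (l : R) : open [set x | l%:E < M x].
Proof.
have [l0|l0] := ltP l 0%R.
  rewrite (_ : mkset _ = setT); first exact: openT.
  apply/seteqP; split => // x _ /=; apply: lt_le_trans (hardy_littlewood_ge0 x).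
  by rewrite lte_fin.
rewrite openE => x /= /hardy_littlewood_gtP[r [r0 lr]].
pose F k : set T := eball x (r - k.+1%:R^-1).
have mF k : measurable (F k) by exact: measurable_eball.
have [k lk] : exists k, l%:E * mu (eball x r) < I (F k).
  apply: nondecreasing_measure_gt => //.
    move=> i j ij; apply/subsetPset => y; rewrite /F /eball/= => /lt_le_trans; apply.
    by rewrite lerD2l lerN2 lef_pV2 ?posrE// ler_nat.
  apply: (lt_le_trans lr); rewrite le_measure ?inE//.
  - exact: measurable_eball.
  - exact: bigcupT_measurable.
  - move=> y yr; have [k yk] := ltr_add_invr yr.
    by exists k => //; rewrite /F /eball/= ltrBrDr.
pose e : R := k.+1%:R^-1%R; rewrite /F -/e in lk; have e0 : (0 < e)%R by rewrite invr_gt0.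
have re : (0 < r - e)%R.
  rewrite ltNge; apply/negP => re; move: lk; rewrite [X in I X](_ : _ = set0).
    by rewrite measure0 ltNge mule_ge0.
  apply/seteqP; split => // y /lt_le_trans/(_ re).
  by rewrite ltNge enorm_ge0.
have : nbhs x (eball x (e / 2)).
  by apply: open_nbhs_nbhs; split; [exact: open_eball|
    rewrite /eball/= subrr enorm0 divr_gt0].
apply: filterS => y xy; apply/hardy_littlewood_gtP.
exists (r - e / 2)%R; split; first by lra.
apply: (@le_lt_trans _ _ (l%:E * mu (eball x r))).
  rewrite lee_wpmul2l// le_measure ?inE//; try exact: measurable_eball.
  move=> z; rewrite /eball/= => zy.
  by have := ler_enorm_sub z y x; move: xy; rewrite /eball/=; lra.
apply: (lt_le_trans lk); rewrite le_measure ?inE//; try exact: measurable_eball.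
move=> z; rewrite /eball/= => zy.
have := ler_enorm_sub z x y; move: xy; rewrite /eball/= (enormB x y); lra.
Qed.

Lemma measurable_hardy_littlewood : measurable_fun [set: T] (M : T -> \bar R).
Proof.
apply: (measurability _ (ErealGenOInfty.measurableE R)).
move=> /= _ [_ [a ->]] <-; apply: measurableI => //.
rewrite preimage_itvoy; apply: open_lebesgue_measurable.
exact: open_hardy_littlewood_gt.
Qed.

Lemma measurable_hardy_littlewood_gt (l : R) : measurable ([set x | l%:E < M x] : set T).
Proof. by apply: open_lebesgue_measurable; exact: open_hardy_littlewood_gt. Qed.

(** The cube of half-side 3 r has volume (6 r)^n = (6 n)^n (r / n)^n, and (r / n)^n is the lower
    bound for the volume of the Euclidean ball of radius r. *)
Definition weak_const : R := (6 * N) ^+ n.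

Lemma weak_type (l : R) : (0 < l)%R ->
  mu [set x | l%:E < M x] <=
  (2 / l * weak_const)%:E * \int[mu]_(x in [set x | (l / 2 < `|f x|)%R]) `|(f x)%:E|.
Proof.
move=> l0; pose S : set T := [set x | (l / 2 < `|f x|)%R].
have mS : measurable S by exact: measurable_abs_gt.
have mg : measurable_fun [set: T] (f \_ S : T -> R).
  by apply/(measurable_restrictT _ _).1 => //; exact: measurable_funS mf.
have gE x : `|((f \_ S) x)%:E| = ((fun x => `|(f x)%:E|) \_ S) x.
  by rewrite /patch; case: ifPn => // _; rewrite abse0.
have -> : \int[mu]_(x in S) `|(f x)%:E| = abs_density mu mg setT.
  by rewrite /abs_density; under [RHS]eq_integral do rewrite gE; rewrite -integral_mkcondr setTI.
have C0 : (0 <= 2 / l * weak_const)%R.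
  by rewrite mulr_ge0 ?divr_ge0 ?exprn_ge0 ?mulr_ge0// ltW.
apply: covering_ex => //; first exact: measurable_hardy_littlewood_gt.
move=> x /hardy_littlewood_gtP[r [r0 lr]]; exists r; split => //.
have [v v0 vE] := lebesgue_eball_fin x r0.
have mB := measurable_eball x r.
(* Pointwise |f| is at most its part on [S] plus l / 2; the second term uses up only half of the
   average l, so the large part of f alone averages more than l / 2. *)
have : (l / 2 * v)%:E < abs_density mu mg (eball x r).
  have : (l * v)%:E < abs_density mu mg (eball x r) + (l / 2 * v)%:E.
    rewrite EFinM -vE; apply: (lt_le_trans lr).
    have -> : (l / 2 * v)%:E = \int[mu]_(y in eball x r) (l / 2)%:E.
      by rewrite integral_cst// EFinM -vE.
    rewrite /abs_density -ge0_integralD//; last 2 first.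
    - exact: measurable_abs_density.
    - by move=> y _; rewrite lee_fin divr_ge0// ltW.
    apply: ge0_le_integral => //.
    - exact: measurable_abs_density.
    - apply: emeasurable_funD; [exact: measurable_abs_density|exact: measurable_cst].
    - move=> y _; rewrite /patch; case: ifPn => [_|].
        by rewrite leeDl// lee_fin divr_ge0// ltW.
      by move/negP; rewrite inE /S/= => /negP; rewrite -leNgt /= normr0 add0e lee_fin.
  rewrite {1}(_ : l * v = l / 2 * v + l / 2 * v)%R; last by field.
  by rewrite EFinD lteD2rE.
move=> /ltW lv; rewrite setIT.
have r30 : (0 < 3 * r)%R by rewrite mulr_gt0.
apply: (@le_trans _ _ ((2 * (3 * r)) ^+ n)%:E).
  rewrite -(lebesgue_ball x r30); exact: lexx.
have vr := lebesgue_eball_ge x r0; rewrite vE lee_fin in vr.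
apply: (@le_trans _ _ ((2 / l * weak_const)%:E * (l / 2 * v)%:E)); last first.
  rewrite lee_wpmul2l// (le_trans lv)// le_measure ?inE//.
    exact: measurable_ball_lebesgue.
  exact: eball_sub_ball.
rewrite -EFinM lee_fin.
have -> : (2 * (3 * r) = 6 * N * (r / N))%R by field; rewrite gt_eqF.
rewrite exprMn -/weak_const.
have -> : (2 / l * weak_const * (l / 2 * v) = weak_const * v)%R by field; rewrite gt_eqF.
by rewrite ler_wpM2l// exprn_ge0// mulr_ge0.
Qed.

End hardy_littlewood_bounds.

(** * Converse of the weak type inequality inside the ball carrying f *)

Section reverse_weak_type.
Context {R : realType} {n : nat} (n_gt0 : (0 < n)%N).
Notation T := (Lebesgue_rV R n).
Notation mu := (@lebesgue_rV R n).
Notation N := (n%:R : R).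
Variable f : 'rV[R]_n -> R.
Hypothesis mf : measurable_fun [set: T] (f : T -> R).
Variables (c : 'rV[R]_n) (r : R).
Hypotheses (r_gt0 : 0 < r) (f_supp : [set x | f x != 0] `<=` closed_eball c r).
Local Open Scope ereal_scope.
Notation M := (hardy_littlewood f).
Notation I := (abs_density mu mf).

Let N0 : (0 < N)%R. Proof. by rewrite ltr0n. Qed.

(** Chosen so that k0 (4 n)^n = 1 / 2: the Euclidean ball of radius 4 n t contains the cube of
    half-side 3 t, and its volume is at most (4 n)^n times that of the cube of half-side t. *)
Definition lower_const : R := ((4 * N) ^+ n)^-1 / 2.
Notation k0 := lower_const.

Lemma lower_const_gt0 : (0 < k0)%R.
Proof. by rewrite divr_gt0// invr_gt0 exprn_gt0// mulr_gt0. Qed.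

Lemma lebesgue_ball_lty (x : 'rV[R]_n) s : mu (ball x s) < +oo.
Proof.
have [s0|s0] := ltP 0%R s; first by rewrite lebesgue_ball ?ltry.
rewrite (_ : ball x s = set0) ?measure0 ?ltry//.
by apply/seteqP; split => // y /rV_ballP[/lt_le_trans/(_ s0)]; rewrite ltxx.
Qed.

(* A weak form of Lebesgue's differentiation theorem: |f| <= M f / k0 a.e. *)
Lemma abs_le_hardy_littlewood_ae (s : R) : (0 < s)%R ->
  mu ([set x | (s < `|f x|)%R] `&` [set x | M x <= (k0 * s)%:E]) = 0.
Proof.
move=> s0; set E := _ `&` _.
have mE : measurable (E : set T).
  apply: measurableI; first exact: measurable_abs_gt.
  rewrite (_ : [set x | _] = ~` [set x | (k0 * s)%:E < M x]).
    by apply: measurableC; exact: measurable_hardy_littlewood_gt.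
  by apply/seteqP; split => x /=; rewrite leNgt => /negP.
have EB : E `<=` ball c (r + 1).
  move=> x [/= sx _]; apply: (@closed_eball_sub_ball _ _ _ r); first by rewrite ltrDl.
  by apply: f_supp => /=; rewrite -normr_gt0 (lt_trans s0).
have mulE : s%:E * mu E <= I E.
  rewrite /abs_density -(integral_cst mu mE); apply: ge0_le_integral.
  - exact: mE.
  - by move=> x _; rewrite lee_fin ltW.
  - exact: measurable_cst.
  - exact: measurable_abs_density.
  - by move=> x [/= sx _]; rewrite lee_fin ltW.
have Efin : mu E \is a fin_num.
  rewrite ge0_fin_numE//; apply: le_lt_trans (lebesgue_ball_lty c (r + 1)).
  by rewrite le_measure ?inE//; exact: measurable_ball_lebesgue.
apply/eqP; rewrite eq_le measure_ge0 andbT; apply/lee_addgt0Pr => e e0.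
rewrite add0e; have [U [oU EU UE]] := lebesgue_outer_regular mE EB e0.
(* On E the averages of |f| are so small that cubes inside U give I E at most (s / 2) mu U. Combined
   with s mu E <= I E and mu U <= mu E + e, this forces mu E <= e. *)
have : I E <= (s / 2)%:E * mu U.
  apply: covering_ex => //; first exact: open_lebesgue_measurable.
    by rewrite divr_ge0// ltW.
  move=> x Ex; have /nbhs_ballP[t /= t0 xtU] : nbhs x U.
    by apply: open_nbhs_nbhs; split => //; exact: EU.
  exists t; split => //; rewrite (setIidl xtU).
  have t40 : (0 < 4 * N * t)%R by rewrite !mulr_gt0.
  apply: (@le_trans _ _ (I (eball x (4 * N * t)))).
    rewrite le_measure ?inE//; first exact: measurable_ball_lebesgue.
      exact: measurable_eball.
    by apply: ball_sub_eball; rewrite mulrA (mulrC N) ltr_pM2r// ltr_pM2r// ltr_nat.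
  apply: (le_trans (hardy_littlewood_leP n_gt0 mf Ex.2 t40)).
  apply: (@le_trans _ _ ((k0 * s)%:E * ((2 * (4 * N * t)) ^+ n)%:E)).
    rewrite lee_wpmul2l ?lebesgue_eball_le// lee_fin mulr_ge0 ?ltW//.
    exact: lower_const_gt0.
  rewrite lebesgue_ball// -!EFinM lee_fin.
  have -> : (2 * (4 * N * t) = 4 * N * (2 * t))%R by ring.
  rewrite exprMn /k0; set a := ((4 * N) ^+ n)%R.
  have a0 : (0 < a)%R by rewrite exprn_gt0// mulr_gt0.
  rewrite le_eqVlt; apply/orP; left; apply/eqP; field; exact: lt0r_neq0.
move=> /(le_trans mulE) /le_trans.
have s20 : (0 <= (s / 2)%:E) by rewrite lee_fin divr_ge0// ltW.
have [m mEm] : exists m : R, mu E = m%:E by exists (fine (mu E)); rewrite fineK.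
have UE' : mu U <= (m + e)%:E by rewrite EFinD -mEm.
move=> /(_ _ (lee_wpmul2l s20 UE')).
rewrite mEm -!EFinM !lee_fin -[(m <= e)%R](ler_pM2l s0).
lra.
Qed.

(** Moving x towards c by the fraction t / (2 r) displaces it by at most t / 2 and brings it to
    within r - t / 2 of c. The cube of half-side t / (2 n) around the new point then fits both in
    the cube around x and in the closed ball, even when x lies on the boundary. *)
Lemma closed_eball_thick (x : 'rV[R]_n) (t : R) : closed_eball c r x ->
  (0 < t)%R -> (t <= r)%R ->
  ((t / N) ^+ n)%:E <= mu (ball x t `&` closed_eball c r).
Proof.
move=> xB t0 tr; pose th := (t / (2 * r))%R; pose x' := (x + th *: (c - x))%R.
have th0 : (0 < th)%R by rewrite divr_gt0// mulr_gt0.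
have th1 : (th <= 1)%R.
  by rewrite ler_pdivrMr ?mulr_gt0// mul1r (le_trans tr)// ler_peMl ?ler1n// ltW.
pose dl := (t / (2 * N))%R; have dl0 : (0 < dl)%R by rewrite divr_gt0// mulr_gt0.
have cx : (enorm (c - x) <= r)%R by rewrite enormB.
have -> : (t / N = 2 * dl)%R by rewrite /dl; field; rewrite gt_eqF.
rewrite -(lebesgue_ball x')// le_measure ?inE//.
- exact: measurable_ball_lebesgue.
- apply: measurableI; first exact: measurable_ball_lebesgue.
  exact: measurable_closed_eball.
move=> y x'y; split.
  apply/rV_ballP; split => // i.
  have := (iffLR (rV_ballP _ _ _) x'y).2 i; rewrite !mxE => yi.
  have h1 : (`|th * (c 0 i - x 0 i)| <= t / 2)%R.
    rewrite normrM gtr0_norm//.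
    have /le_trans/(_ cx) : (`|c 0 i - x 0 i| <= enorm (c - x))%R.
      by have := coord_le_enorm (c - x) i; rewrite !mxE.
    rewrite -(ler_pM2l th0) => /le_trans; apply.
    by rewrite /th (_ : t / (2 * r) * r = t / 2)%R//; field; rewrite gt_eqF.
  have h2 : (dl <= t / 2)%R.
    rewrite /dl invfM mulrA ler_pdivrMr// ler_peMr ?divr_ge0 ?(ltW t0)//.
    by rewrite ler1n.
  have -> : (x 0 i - y 0 i = (x 0 i + th * (c 0 i - x 0 i) - y 0 i) - th * (c 0 i - x 0 i))%R by ring.
  rewrite (le_lt_trans (ler_normB _ _))//; lra.
have := ball_sub_closed_eball x'y; rewrite /closed_eball/= => yx'.
rewrite (le_trans (ler_enorm_sub y x' c))//.
have -> : (x' - c = (1 - th) *: (x - c))%R.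
  by apply/rowP => i; rewrite !mxE; ring.
rewrite enormZ ger0_norm ?subr_ge0//.
have /(ler_wpM2l (_ : 0 <= 1 - th)%R) : (enorm (x - c) <= r)%R by exact: xB.
rewrite subr_ge0 => /(_ th1) h.
have : (N * dl <= th * r)%R.
  rewrite /dl /th (_ : N * _ = t / 2)%R; last by field; rewrite gt_eqF.
  by rewrite (_ : t / (2 * r) * r = t / 2)%R//; field; rewrite gt_eqF.
lra.
Qed.

Lemma abs_density_supp (S : set T) : measurable S -> closed_eball c r `<=` S ->
  I S = I setT.
Proof.
move=> mS BS; rewrite /abs_density [LHS]integral_mkcond; apply: eq_integral => x _.
rewrite /patch; case: ifPn => // /negP xS.
have [->|/f_supp/BS xS'] := eqVneq (f x) 0%R; first by rewrite abse0.
by case: xS; rewrite inE.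
Qed.

(** A stopping-time argument in the style of Calderon and Zygmund. Outside a null set |f| > s forces
    M f > k0 s, so some cube around x carries much of the mass of |f|. Its size is tripled until
    this fails. The last good cube makes M f large at all of its points, while failure at three
    times its size is the bound that the covering lemma asks for. *)
Lemma reverse_weak_type : I setT < +oo ->
  exists A k s0 : R, [/\ (0 < A)%R, (0 < k)%R, (0 < s0)%R & forall s, (s0 <= s)%R ->
    \int[mu]_(x in [set x | (s < `|f x|)%R]) `|(f x)%:E| <=
    (A * s)%:E * mu (closed_eball c r `&` [set x | (k * s)%:E < M x])].
Proof.
move=> Ifin; pose k := (k0 * ((6 * N ^+ 2) ^+ n)^-1)%R.
have [F F0 FE] : exists2 F : R, (0 <= F)%R & I setT = F%:E.
  exists (fine (I setT)); first by rewrite fine_ge0.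
  by rewrite fineK// ge0_fin_numE.
have k00 := lower_const_gt0; have F10 : (0 < F + 1)%R by lra.
(* From [s0] on, the whole mass F lies below the threshold attached to a cube of half-side r, so
   every good cube is smaller than r. Adding 1 makes this strict and keeps [s0] positive. *)
pose s0 := ((F + 1) / (k0 * (r / N) ^+ n))%R.
have rN0 : (0 < (r / N) ^+ n)%R by rewrite exprn_gt0// divr_gt0.
have kr0 : (0 < k0 * (r / N) ^+ n)%R by exact: mulr_gt0.
have s00 : (0 < s0)%R by exact: divr_gt0.
have X0 : (0 < (6 * N ^+ 2) ^+ n)%R by rewrite exprn_gt0// mulr_gt0// exprn_gt0.
have kgt0 : (0 < k)%R by apply: mulr_gt0 => //; rewrite invr_gt0.
exists (k0 * 3 ^+ n)%R, k, s0; split => //.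
  by apply: mulr_gt0 => //; exact: exprn_gt0.
move=> s s0s; have sgt0 : (0 < s)%R by exact: lt_le_trans s0s.
have Fs : (F < k0 * s * (r / N) ^+ n)%R.
  rewrite mulrAC mulrC -ltr_pdivrMr//; apply: lt_le_trans s0s.
  by rewrite /s0 ltr_pM2r ?ltrDl// invr_gt0.
pose E : set T := [set x | (s < `|f x|)%R] `&` [set x | (k0 * s)%:E < M x].
pose Z : set T := [set x | (s < `|f x|)%R] `&` [set x | M x <= (k0 * s)%:E].
have mE : measurable E.
  apply: measurableI; first exact: measurable_abs_gt.
  exact: measurable_hardy_littlewood_gt.
have SE : [set x | (s < `|f x|)%R] = E `|` Z.
  rewrite -setIUr; apply/seteqP; split => x /=; last by case.
  by split => //; have [|] := leP (M x) (k0 * s)%:E; [right|left].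
have mZ : measurable Z.
  have -> : Z = [set x | (s < `|f x|)%R] `\` [set x | (k0 * s)%:E < M x].
    apply/seteqP; split => x [sx /= Mx]; split => //=.
      by apply/negP; rewrite -leNgt.
    by rewrite leNgt; apply/negP.
  apply: measurableD; first exact: measurable_abs_gt.
  exact: measurable_hardy_littlewood_gt.
apply: (@le_trans _ _ (I (E `|` Z))); first by rewrite -SE.
apply: (@le_trans _ _ (I E)).
  apply: (@le_trans _ _ (I E + I Z)).
    exact: (measureU2 (abs_density mu mf)).
  have -> : I Z = 0; last by rewrite adde0.
  have Z0 : mu Z = 0 by exact: abs_le_hardy_littlewood_ae.
  by rewrite /abs_density (null_set_integral mZ (measurable_abs_density mf mZ) Z0).
apply: covering_ex => //.
- apply: measurableI; first exact: measurable_closed_eball.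
  exact: measurable_hardy_littlewood_gt.
- by rewrite !mulr_ge0 ?exprn_ge0// ltW.
move=> x [/= sx /(hardy_littlewood_gtP n_gt0 mf)[t [t0 xt]]].
have xB : closed_eball c r x by apply: f_supp => /=; rewrite -normr_gt0 (lt_trans sgt0).
pose P (u : R) := (k0 * s * (u / N) ^+ n)%:E < I (ball x u).
have Pt : P t.
  apply: (@lt_le_trans _ _ (I (eball x t))); last first.
    rewrite le_measure ?inE//; first exact: measurable_eball.
      exact: measurable_ball_lebesgue.
    exact: eball_sub_ball.
  apply: le_lt_trans xt; rewrite EFinM lee_wpmul2l ?lee_fin ?mulr_ge0 ?(ltW sgt0) ?(ltW k00)//.
  exact: lebesgue_eball_ge.
have PF u : (0 < u)%R -> P u -> (u < r)%R.
  move=> u0 Pu; rewrite ltNge; apply/negP => ru; move: Pu; apply/negP; rewrite -leNgt.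
  apply: (@le_trans _ _ F%:E).
    rewrite -FE le_measure ?inE//; exact: measurable_ball_lebesgue.
  rewrite lee_fin (le_trans (ltW Fs))// ler_wpM2l ?mulr_ge0 ?(ltW sgt0) ?(ltW k00)//.
  by rewrite lerXn2r ?nnegrE ?divr_ge0 ?(ltW u0) ?(ltW r_gt0)// ler_pM2r ?invr_gt0.
have exj : exists j, ~~ `[< P (3 ^+ j * t)%R >].
  have [j jr] : exists j : nat, (r <= 3 ^+ j * t)%R.
    exists (Num.truncn (r / t)).+1; rewrite -ler_pdivrMr//.
    apply: (le_trans (ltW (truncnS_gt _))).
    rewrite -natrX ler_nat; apply: ltnW; apply: ltn_expl.
    by [].
  exists j; apply/asboolP => /PF; rewrite mulr_gt0 ?exprn_gt0// => /(_ isT).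
  by rewrite ltNge jr.
case: (ex_minnP exj) => -[|j] /asboolP nP jmin; first by move: nP; rewrite expr0 mul1r.
pose u := (3 ^+ j * t)%R; have u0 : (0 < u)%R by rewrite mulr_gt0 ?exprn_gt0.
have Pu : P u.
  by apply: contrapT => nPu; have := jmin j; rewrite ltnn; move=> H; have := H (introN (asboolP _) nPu).
have nP3 : ~ P (3 * u)%R by rewrite /u mulrA -exprS.
exists u; split; first exact: u0.
apply: (@le_trans _ _ (k0 * s * (3 * u / N) ^+ n)%:E).
  by rewrite leNgt; apply/negP; exact: nP3.
have ur := PF _ u0 Pu.
apply: (@le_trans _ _ ((k0 * 3 ^+ n * s)%:E * ((u / N) ^+ n)%:E)).
  rewrite -EFinM lee_fin (_ : 3 * u / N = 3 * (u / N))%R; last by ring.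
  rewrite exprMn le_eqVlt; apply/orP; left; apply/eqP; ring.
apply: lee_wpmul2l.
  by rewrite lee_fin ?mulr_ge0 ?exprn_ge0 ?(ltW sgt0) ?(ltW k00).
apply: (le_trans (closed_eball_thick xB u0 (ltW ur))).
apply: le_measure; rewrite ?inE.
- apply: measurableI; first exact: measurable_ball_lebesgue.
  exact: measurable_closed_eball.
- apply: measurableI; first exact: measurable_ball_lebesgue.
  apply: measurableI; first exact: measurable_closed_eball.
  exact: measurable_hardy_littlewood_gt.
move=> y [xy By]; split; first exact: xy.
split; first exact: By.
(* The ball of radius 3 n u around y contains the cube of half-side 2 u around y, hence the cube of
   half-side u around x. Its volume is at most (6 n^2)^n (u / n)^n, the factor divided out in
   [k]. *)
apply/(hardy_littlewood_gtP n_gt0 mf); exists (3 * N * u)%R.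
have Nu0 : (0 < 3 * N * u)%R by rewrite !mulr_gt0.
split; first exact: Nu0.
apply: (@le_lt_trans _ _ ((k * s)%:E * ((2 * (3 * N * u)) ^+ n)%:E)).
  apply: lee_wpmul2l; last exact: lebesgue_eball_le.
  by rewrite lee_fin; apply: mulr_ge0; exact: ltW.
apply: (@le_lt_trans _ _ (k0 * s * (u / N) ^+ n)%:E).
  rewrite -EFinM lee_fin /k le_eqVlt; apply/orP; left; apply/eqP.
  have -> : (2 * (3 * N * u) = 6 * N ^+ 2 * (u / N))%R by field; exact: lt0r_neq0 N0.
  move: (6 * N ^+ 2)%R X0 => X X0; rewrite exprMn; field.
  exact: lt0r_neq0 X0.
apply: (lt_le_trans Pu); apply: le_measure; rewrite ?inE.
- exact: measurable_ball_lebesgue.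
- exact: measurable_eball.
move=> z xz; clear -N0 u0 xy xz; apply: (@ball_sub_eball _ _ _ (2 * u)%R).
  by rewrite mulrA ltr_pM2r// mulrC ltr_pM2r// ltr_nat.
move: xy xz => /rV_ballP[_ xy] /rV_ballP[_ xz]; apply/rV_ballP.
split => [|i]; first by rewrite mulr_gt0.
have := ler_distD (x 0%R i) (y 0%R i) (z 0%R i); have := xy i; have := xz i.
rewrite (distrC (x _ _) (y _ _)); lra.
Qed.

End reverse_weak_type.

(** * The integral of psi(s) / s *)

Section completed_intervals.
Context {R : realType}.
Notation m := (@completed_lebesgue_measure R).
Implicit Types (a b c : R) (h : R -> R).

Definition segment_integral h a b : R := \int[m]_(s in `[a, b]) h s.

Lemma measurable_completed (A : set R) : measurable (A : set (measurableTypeR R)) ->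
  (wlength idfun)^*%mu.-cara.-measurable A.
Proof. exact: sub_caratheodory. Qed.

Lemma measurable_itv_completed (i : interval R) :
  (wlength idfun)^*%mu.-cara.-measurable [set` i].
Proof. by apply: measurable_completed; exact: measurable_itv. Qed.

Let itv_split a b c : a <= b -> b <= c ->
  `[a, c]%classic = `[a, b] `|` `]b, c].
Proof.
move=> ab bc; apply/seteqP; split => x /=; rewrite !in_itv/=.
  by move=> /andP[ax xc]; have [xb|bx] := leP x b; [left|right]; apply/andP.
by move=> [/andP[ax xb]|/andP[bx xc]]; apply/andP; split => //;
  [exact: le_trans bc|exact/ltW/(le_lt_trans ab)].
Qed.

Let itv_cons b c : b <= c -> `[b, c]%classic = [set b] `|` `]b, c].
Proof.
move=> bc; apply/seteqP; split => x /=; rewrite !in_itv/=.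
  by move=> /andP[]; rewrite le_eqVlt => /predU1P[->|bx xc]; [left|right; rewrite bx].
by move=> [->|/andP[/ltW -> ->]//]; rewrite lexx.
Qed.

Let null_point b : m [set b] = 0%E.
Proof. exact: (@lebesgue_measure_set1 R b). Qed.

Lemma segment_integralD h a b c : a <= b -> b <= c ->
  m.-integrable `[a, c] (EFin \o h) ->
  segment_integral h a c = segment_integral h a b + segment_integral h b c.
Proof.
move=> ab bc ih; have mi := measurable_itv_completed.
have ioc : m.-integrable `]b, c] (EFin \o h).
  by apply: integrableS ih => //; rewrite (itv_split ab bc); exact: subsetUr.
have ibc : m.-integrable `[b, c] (EFin \o h).
  apply: integrableS ih => // x /=; rewrite !in_itv/= => /andP[bx ->].
  by rewrite (le_trans ab).
rewrite /segment_integral (itv_split ab bc) Rintegral_setU//; last 2 first.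
- by rewrite -itv_split.
- apply/disj_setPS => x [/=]; rewrite !in_itv/= => /andP[_ xb] /andP[bx _].
  by move: bx; rewrite ltNge xb.
rewrite (itv_cons bc) in ibc *; congr (_ + _).
have mb : (wlength idfun)^*%mu.-cara.-measurable [set b].
  by have := mi `[b, b]; rewrite set_itv1.
rewrite [RHS]Rintegral_setU//; last first.
  by apply/disj_setPS => x [/= ->]; rewrite in_itv/= ltxx.
rewrite [X in _ = X + _](_ : _ = 0) ?add0r// /Rintegral.
have ib : m.-integrable [set b] (EFin \o h).
  by apply: integrableS ibc => //; do ?[exact: subsetUl|exact: measurableU].
by rewrite (null_set_integral mb (measurable_int m ib) (null_point b)).
Qed.

End completed_intervals.

Section weighted_integral.
Context {R : realType}.
Notation m := (@completed_lebesgue_measure R).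
Variables (phi psi : R -> R).
Hypothesis psi_int : forall t, 0 <= t -> m.-integrable `[0, t] (EFin \o psi).
Hypothesis phiE : forall t, 0 <= t -> (phi t)%:E = (\int[m]_(s in `[0%R, t]) (psi s)%:E)%E.
Hypothesis phi_nd : forall s t, 0 <= s -> s <= t -> phi s <= phi t.
Implicit Types a b c : R.

Definition weighted a b : R := segment_integral (fun s => psi s / s) a b.

Let mi := @measurable_itv_completed R.

Let psi_int_seg a b : 0 <= a -> m.-integrable `[a, b] (EFin \o psi).
Proof.
move=> a0; have [ab|ba] := leP a b; last first.
  by rewrite set_itv_ge ?bnd_simp -?ltNge//; exact: integrable_set0.
apply: integrableS (psi_int (le_trans a0 ab)) => // x /=; rewrite !in_itv/= => /andP[ax ->].
by rewrite (le_trans a0 ax).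
Qed.

Lemma phi_increment a b : 0 <= a -> a <= b ->
  segment_integral psi a b = phi b - phi a.
Proof.
move=> a0 ab; have E t : 0 <= t -> phi t = segment_integral psi 0 t.
  by move=> t0; rewrite /segment_integral /Rintegral -phiE.
rewrite (E b) ?(le_trans a0)// (E a)// (segment_integralD a0 ab).
  by ring.
exact: psi_int_seg.
Qed.

Lemma weighted_integrable a b : 0 < a ->
  m.-integrable `[a, b] (EFin \o (fun s => psi s / s)).
Proof.
move=> a0; have ip := psi_int_seg b (ltW a0).
have mp := measurable_int _ ip.
have minv : measurable_fun (`[a, b] : set (caratheodory_type (@wlength R idfun)^*%mu))
    (fun s : R => s^-1).
  move=> _ Y mY; apply: measurable_completed.
  apply: (_ : measurable_fun (`[a, b] : set (measurableTypeR R)) (fun s : R => s^-1)) => //.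
  apply: subspace_continuous_measurable_fun; first exact: measurable_itv.
  apply: continuous_in_subspaceT => s; rewrite inE/= in_itv/= => /andP[as_ _].
  by apply: inv_continuous; rewrite gt_eqF// (lt_le_trans a0).
apply: (@le_integrable _ _ _ m _ (mi _) _ (fun s => (a^-1)%:E * `|(psi s)%:E|)%E).
- apply/measurable_EFinP; apply: measurable_funM => //; exact/measurable_EFinP.
- move=> s /=; rewrite in_itv/= => /andP[as_ _].
  have s0 : 0 < s := lt_le_trans a0 as_.
  rewrite lee_fin [leRHS]ger0_norm ?mulr_ge0 ?invr_ge0 ?(ltW a0)//.
  rewrite normrM mulrC ler_wpM2r// gtr0_norm ?invr_gt0// lef_pV2 ?posrE//.
- by apply: integrableZl => //; exact: integrable_abse.
Qed.

Definition total_variation a b : R := segment_integral (fun s => `|psi s|) a b.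

Lemma weightedD a b c : 0 < a -> a <= b -> b <= c ->
  weighted a c = weighted a b + weighted b c.
Proof.
by move=> a0 ab bc; apply: segment_integralD => //; exact: weighted_integrable.
Qed.

Let norm_psi_int a b : 0 <= a -> m.-integrable `[a, b] (EFin \o (fun s => `|psi s|)).
Proof. by move=> a0; apply: (integrable_norm (psi_int_seg b a0)). Qed.

Lemma total_variationD a b c : 0 <= a -> a <= b -> b <= c ->
  total_variation a c = total_variation a b + total_variation b c.
Proof.
by move=> a0 ab bc; apply: segment_integralD => //; exact: norm_psi_int.
Qed.

Lemma total_variation_ge0 a b : 0 <= total_variation a b.
Proof. exact: Rintegral_ge0. Qed.

(** Replacing 1 / s by a constant between 1 / b and 1 / a changes the integrand by at most (1 / a -
    1 / b) |psi|. The error involves the integral of |psi| because no pointwise sign of psi is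
    known. *)
Let weighted_crude a b : 0 < a -> a <= b ->
  `|weighted a b - (phi b - phi a) / a| <= (a^-1 - b^-1) * total_variation a b /\
  `|weighted a b - (phi b - phi a) / b| <= (a^-1 - b^-1) * total_variation a b.
Proof.
move=> a0 ab; have b0 := lt_le_trans a0 ab.
have H k : b^-1 <= k -> k <= a^-1 ->
  `|weighted a b - (phi b - phi a) * k| <= (a^-1 - b^-1) * total_variation a b.
  move=> bk ka; rewrite -(phi_increment (ltW a0) ab) -RintegralZr; last 2 first.
  - exact: mi.
  - exact: psi_int_seg (ltW a0).
  have ik : m.-integrable `[a, b] (EFin \o (fun s => psi s * k)).
    exact: (integrableZr (mi _) k (psi_int_seg b (ltW a0))).
  rewrite -RintegralB; last 3 first.
  - exact: mi.
  - exact: weighted_integrable.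
  - exact: ik.
  have id := integrableB (mi _) (weighted_integrable b a0) ik.
  apply: (le_trans (le_normr_Rintegral _ _)); [exact: mi|exact: id|].
  rewrite -RintegralZl; last 2 first.
  - exact: mi.
  - exact: norm_psi_int (ltW a0).
  apply: le_Rintegral; first exact: mi.
  - exact: (integrable_norm id).
  - exact: (integrableZl (mi _) (a^-1 - b^-1) (norm_psi_int b (ltW a0))).
  move=> s /=; rewrite in_itv/= => /andP[as_ sb].
  have s0 : 0 < s := lt_le_trans a0 as_.
  rewrite -mulrBr normrM mulrC ler_wpM2r//.
  have h1 : s^-1 <= a^-1 by rewrite lef_pV2 ?posrE.
  have h2 : b^-1 <= s^-1 by rewrite lef_pV2 ?posrE.
  by rewrite ler_norml; apply/andP; split; lra.
by split; apply: H; rewrite ?lexx// lef_pV2 ?posrE.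
Qed.

(* Bisecting the interval k times divides the error of the crude bound by 2^k,
   so the sign of psi plays no role. *)
Let weighted_bisect al a b k : 0 < al -> al <= a -> a <= b ->
  weighted a b <= (phi b - phi a) / a + (b - a) / 2 ^+ k / al ^+ 2 * total_variation a b /\
  (phi b - phi a) / b - (b - a) / 2 ^+ k / al ^+ 2 * total_variation a b <= weighted a b.
Proof.
move=> al0; elim: k a b => [|k IH] a b ala ab.
  have a0 := lt_le_trans al0 ala; have b0 := lt_le_trans a0 ab.
  have [h1 h2] := weighted_crude a0 ab.
  have : (a^-1 - b^-1) * total_variation a b <=
      (b - a) / 2 ^+ 0 / al ^+ 2 * total_variation a b.
    rewrite ler_wpM2r ?total_variation_ge0// expr0 divr1.
    have -> : a^-1 - b^-1 = (b - a) / (a * b) by field; rewrite !gt_eqF.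
    rewrite ler_wpM2l ?subr_ge0// lef_pV2 ?posrE ?exprn_gt0 ?mulr_gt0//.
    by rewrite expr2; apply: ler_pM; rewrite ?(ltW al0)// (le_trans ala).
  by move: h1 h2; rewrite !ler_norml => /andP[? ?] /andP[? ?]; lra.
have a0 := lt_le_trans al0 ala; have b0 := lt_le_trans a0 ab.
pose c := (a + b) / 2.
have ac : a <= c by rewrite /c; lra.
have cb : c <= b by rewrite /c; lra.
have [h1 h1'] := IH a c ala ac.
have [h2 h2'] := IH c b (le_trans ala ac) cb.
rewrite (weightedD a0 ac cb) (total_variationD (ltW a0) ac cb).
have E1 : c - a = (b - a) / 2 by rewrite /c; field.
have E2 : b - c = (b - a) / 2 by rewrite /c; field.
have E3 : (b - a) / 2 ^+ k.+1 / al ^+ 2 = (b - a) / 2 / 2 ^+ k / al ^+ 2.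
  by rewrite exprS invfM !mulrA.
rewrite E1 in h1 h1'; rewrite E2 in h2 h2'; rewrite E3 mulrDr.
have c0 := lt_le_trans a0 ac.
have pac := phi_nd (ltW a0) ac; have pcb := phi_nd (ltW c0) cb.
(* Monotonicity of [phi] moves the weight 1 / c at the midpoint to 1 / a in the upper bound and to 1
   / b in the lower one, so the halves recombine and only their errors add up. *)
have k1 : (phi b - phi c) / c <= (phi b - phi c) / a.
  by rewrite ler_wpM2l ?subr_ge0// lef_pV2 ?posrE.
have k2 : (phi c - phi a) / b <= (phi c - phi a) / c.
  by rewrite ler_wpM2l ?subr_ge0// lef_pV2 ?posrE.
move: h1 h1' h2 h2'; move: ((b - a) / 2 / 2 ^+ k / al ^+ 2 * total_variation a c) => X.
move: ((b - a) / 2 / 2 ^+ k / al ^+ 2 * total_variation c b) => Y.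
split; lra.
Qed.

Lemma weighted_bounds a b : 0 < a -> a <= b ->
  (phi b - phi a) / b <= weighted a b <= (phi b - phi a) / a.
Proof.
move=> a0 ab.
pose K := (b - a) / a ^+ 2 * total_variation a b.
have K0 : 0 <= K.
  by rewrite mulr_ge0 ?total_variation_ge0// divr_ge0 ?subr_ge0// sqr_ge0.
have H e : 0 < e -> exists k, K / 2 ^+ k <= e.
  move=> e0; exists (Num.truncn (K / e)).+1.
  rewrite ler_pdivrMr ?exprn_gt0// mulrC -ler_pdivrMr//.
  apply: (le_trans (ltW (truncnS_gt _))).
  by rewrite -natrX ler_nat; apply: ltnW; exact: ltn_expl.
have E k : (b - a) / 2 ^+ k / a ^+ 2 * total_variation a b = K / 2 ^+ k.
  by rewrite /K; ring.
apply/andP; split; apply/ler_addgt0Pr => e /H[k Ke].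
  have [_ +] := weighted_bisect k a0 (lexx a) ab; rewrite E; lra.
have [+ _] := weighted_bisect k a0 (lexx a) ab; rewrite E; lra.
Qed.

Lemma weightedE a b : 0 < a ->
  (\int[m]_(s in `[a, b]) (psi s / s)%:E)%E = (weighted a b)%:E.
Proof.
move=> a0; rewrite /weighted /segment_integral /Rintegral fineK//.
by apply: integrable_fin_num; [exact: mi|exact: weighted_integrable].
Qed.

End weighted_integral.

(** * Dyadic sums *)

Section dyadic.
Context {R : realType}.
Variables (al : R) (phi : R -> R) (D : R).
Hypotheses (al_gt0 : 0 < al) (D_gt0 : 0 < D).
Hypothesis phi_ge0 : forall t, 0 <= t -> 0 <= phi t.
Hypothesis phi_nd : forall s t, 0 <= s -> s <= t -> phi s <= phi t.
Hypothesis phi_doubling : forall t, 0 <= t -> phi (2 * t) <= D * phi t.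

Definition dyad j : R := 2 ^+ j * al.

Lemma dyad_gt0 j : 0 < dyad j.
Proof. by rewrite mulr_gt0 ?exprn_gt0. Qed.

Let dyad_ge0 j : 0 <= dyad j.
Proof. exact/ltW/dyad_gt0. Qed.

Lemma dyadS j : dyad j.+1 = 2 * dyad j.
Proof. by rewrite /dyad exprS mulrA. Qed.

Lemma dyad_le i j : (i <= j)%N -> dyad i <= dyad j.
Proof. by move=> ij; rewrite ler_pM2r// ler_eXn2l// ltr1n. Qed.

Lemma dyad_ub t : exists j, t <= dyad j.
Proof.
exists (Num.truncn (t / al)).+1; rewrite /dyad -ler_pdivrMr//.
apply: (le_trans (ltW (truncnS_gt _))).
by rewrite -natrX ler_nat; apply: ltnW; exact: ltn_expl.
Qed.

Definition increment j : R := phi (dyad j.+1) - phi (dyad j).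

Lemma increment_ge0 j : 0 <= increment j.
Proof. by rewrite subr_ge0 phi_nd ?dyad_ge0 ?dyad_le. Qed.

Lemma sum_increment k n : \sum_(j < n) increment (j + k) = phi (dyad (n + k)) - phi (dyad k).
Proof.
elim: n => [|n IH]; first by rewrite big_ord0 add0n subrr.
by rewrite big_ord_recr/= IH /increment addSn; ring.
Qed.

(** The sum starts at level 1 because the weak type inequality halves the level: the term at
    [dyad j.+1] turns into one at [dyad j], which must not drop below [al]. *)
Lemma phi_le_sum (M : R) : 0 <= M -> exists n,
  phi M <= phi (dyad 1) + \sum_(j < n) increment j.+1 * (dyad j.+1 < M)%R%:R.
Proof.
move=> M0; have [n] := dyad_ub M; move=> /le_trans/(_ (dyad_le (leqnSn n))) => Mn.
exists n; elim: n Mn => [|n IH] Mn.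
  by rewrite big_ord0 addr0 phi_nd.
have [/IH/le_trans|nM] := leP M (dyad n.+1).
  by apply; rewrite big_ord_recr/= lerD2l lerDl mulr_ge0 ?increment_ge0.
rewrite (eq_bigr (fun j : 'I_n.+1 => increment (j + 1))).
  by rewrite sum_increment addn1 addrC subrK phi_nd.
move=> j _; rewrite addn1 (_ : (_ < M)%R) ?mulr1//.
by apply: le_lt_trans nM; apply: dyad_le; rewrite ltnS -ltnS.
Qed.

Lemma sum_increment_unbounded (L : R) :
  phi t @[t --> +oo] --> +oo -> exists n, L <= \sum_(j < n) increment j.+1.
Proof.
move=> /cvgryPge/(_ (L + phi (dyad 1))) [T [_ HT]].
have [n Tn] := dyad_ub (T + 1); exists n.
under eq_bigr do rewrite -addn1.
rewrite sum_increment addn1 lerBrDr; apply: HT.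
apply: (@lt_le_trans _ _ (T + 1)); first by rewrite ltrDl.
exact: le_trans Tn (dyad_le _).
Qed.

(** The active terms telescope to at most the value of [phi] at the last level below M / k, and q
    doublings bring M / k back to M. *)
Lemma sum_le_phi (k : R) (q : nat) (M : R) n : 0 < k -> k^-1 <= 2 ^+ q -> 0 <= M ->
  \sum_(j < n) increment j * (k * dyad j.+1 < M)%R%:R <= D ^+ q * phi M.
Proof.
move=> k0 kq M0; have Dq : phi (2 ^+ q * M) <= D ^+ q * phi M.
  elim: q {kq} => [|q IH]; first by rewrite !expr0 !mul1r.
  rewrite exprS -mulrA (le_trans (phi_doubling _)) ?mulr_ge0 ?exprn_ge0//.
  by rewrite exprS -mulrA ler_pM2l.
elim: n => [|n IH]; first by rewrite big_ord0 mulr_ge0 ?phi_ge0// exprn_ge0// ltW.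
have [nM|Mn] := ltP (k * dyad n.+1) M; last first.
  by rewrite big_ord_recr/= ltNge Mn/= mulr0 addr0.
rewrite (eq_bigr (fun j : 'I_n.+1 => increment (j + 0))); last first.
  move=> j _; rewrite addn0 (_ : (_ < M)%R) ?mulr1//; apply: le_lt_trans nM.
  by rewrite ler_pM2l//; apply: dyad_le.
rewrite sum_increment addn0; apply: le_trans Dq.
rewrite lerBlDr -[X in X <= _]addr0 lerD//; last by rewrite phi_ge0// dyad_ge0.
rewrite phi_nd ?dyad_ge0//.
apply: (@le_trans _ _ (k^-1 * M)); last by rewrite ler_wpM2r.
by rewrite ler_pdivlMl// ltW.
Qed.

Let a j := phi (dyad j) / dyad j.

Let a_ge0 j : 0 <= a j.
Proof. by rewrite divr_ge0 ?phi_ge0 ?dyad_ge0. Qed.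

(* Abel summation: increments of phi cannot be compared with increments of the
   functions p below (which are only comparable to phi), but values can. *)
Lemma sum_ratio_le k : \sum_(j < k.+1) a j + a k <=
  2 * a 0%N + 2 * \sum_(j < k) increment j / dyad j.+1.
Proof.
elim: k => [|k IH]; first by rewrite big_ord_recr !big_ord0/= mulr0 !addr0 add0r; lra.
rewrite big_ord_recr/= [X in _ <= _ + _ * X]big_ord_recr/= mulrDr.
have -> : increment k / dyad k.+1 = a k.+1 - a k / 2.
  rewrite /increment /a mulrBl dyadS; congr (_ - _); field.
  by rewrite gt_eqF// dyad_gt0.
lra.
Qed.

Lemma phi_shift_ratio j : phi (dyad j.+2) / dyad j <= D ^+ 2 * a j.
Proof.
have d0 := dyad_gt0 j; rewrite /a mulrA ler_pM2r ?invr_gt0//.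
rewrite dyadS (le_trans (phi_doubling _)) ?dyad_ge0//.
rewrite expr2 -mulrA ler_pM2l// dyadS; apply: phi_doubling; exact: ltW.
Qed.

(** * Comparing W with dyadic sums through additivity and endpoint bounds *)

Section weight.
Variables (p : R -> R) (C : R) (W : R -> R -> R).
Hypothesis C_gt0 : 0 < C.
Hypothesis phip : forall t, 0 < t -> phi t <= p t.
Hypothesis pphi : forall t, 0 < t -> p t <= C * phi t.
Hypothesis WD : forall a b c, 0 < a -> a <= b -> b <= c -> W a c = W a b + W b c.
Hypothesis Wge : forall a b, 0 < a -> a <= b -> (p b - p a) / b <= W a b.
Hypothesis Wle : forall a b, 0 < a -> a <= b -> W a b <= (p b - p a) / a.
Hypothesis p_nd : forall s t, 0 <= s -> s <= t -> p s <= p t.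

Let W_ge0 x y : 0 < x -> x <= y -> 0 <= W x y.
Proof.
move=> x0 xy; apply: le_trans (Wge x0 xy).
by rewrite divr_ge0 ?subr_ge0 ?p_nd// ltW// (lt_le_trans x0).
Qed.

Let p_ge0 t : 0 < t -> 0 <= p t.
Proof. by move=> t0; rewrite (le_trans _ (phip t0))// phi_ge0// ltW. Qed.

Let W_le x y : 0 < x -> x <= y -> W x y <= C * phi y / x.
Proof.
move=> x0 xy; apply: (le_trans (Wle x0 xy)); rewrite ler_pM2r ?invr_gt0//.
by rewrite lerBlDr (le_trans (pphi (lt_le_trans x0 xy)))// lerDl p_ge0.
Qed.

Let weight_dyad_le k (T : R) : dyad 0 <= T -> T <= dyad k.+1 ->
  W (dyad 0) T <= C * D * \sum_(j < k.+1) a j.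
Proof.
have step i t : dyad i <= t -> t <= dyad i.+1 -> W (dyad i) t <= C * D * a i.
  move=> it ti; apply: (le_trans (W_le (dyad_gt0 i) it)).
  rewrite /a mulrA ler_pM2r ?invr_gt0 ?dyad_gt0// -mulrA ler_pM2l//.
  apply: le_trans (phi_doubling (ltW (dyad_gt0 i))).
  by rewrite -dyadS phi_nd// (le_trans (ltW (dyad_gt0 i))).
elim: k T => [|k IH] T T0 Tk.
  by rewrite big_ord_recr big_ord0/= add0r; exact: step.
rewrite big_ord_recr/= mulrDr; have [/(IH _ T0)|kT] := leP T (dyad k.+1).
  by move=> /le_trans; apply; rewrite lerDl mulr_ge0 ?a_ge0// mulr_ge0 ?ltW.
rewrite (WD (dyad_gt0 0) (dyad_le (leq0n k.+1)) (ltW kT)).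
by rewrite lerD ?IH ?step ?dyad_le// ltW.
Qed.

(** When T exceeds [dyad k.+1], the first k + 1 indicators are all 1 and [sum_ratio_le] turns values
    of [phi] into increments; otherwise the new term only enlarges the right side. *)
Let weight_dyad_sum k (T : R) : dyad 0 <= T -> T <= dyad k.+1 ->
  W (dyad 0) T <= 2 * C * D * (a 0%N +
    \sum_(j < k) increment j / dyad j.+1 * (dyad j.+1 < T)%R%:R).
Proof.
have CD : 0 <= 2 * C * D by rewrite !mulr_ge0// ltW.
elim: k => [|k IH] T0 Tk.
  apply: (le_trans (weight_dyad_le T0 Tk)); rewrite big_ord_recr !big_ord0/= add0r addr0.
  have : 0 <= C * D * a 0 by apply: mulr_ge0; [apply: mulr_ge0; exact: ltW|exact: a_ge0].
  lra.
have [/(IH T0)/le_trans|kT] := leP T (dyad k.+1).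
  apply; rewrite ler_wpM2l// lerD2l big_ord_recr/= lerDl.
  by rewrite mulr_ge0// divr_ge0 ?increment_ge0// dyad_ge0.
apply: (le_trans (weight_dyad_le T0 Tk)).
rewrite (eq_bigr (fun j : 'I_k.+1 => increment j / dyad j.+1)); last first.
  move=> j _; rewrite (_ : (_ < T)%R) ?mulr1//; apply: le_lt_trans kT.
  exact: dyad_le.
have := sum_ratio_le k.+1; have := a_ge0 k.+1.
move: (\sum_(j < k.+2) a j) (\sum_(j < k.+1) _) => X Y a0 XY.
have : C * D * X <= C * D * (2 * a 0%N + 2 * Y).
  by apply: ler_wpM2l; [apply: mulr_ge0; exact: ltW|lra].
lra.
Qed.

(** The stretch from [al0] to [al], where the converse weak type inequality may fail, contributes
    only a constant; it will multiply |f|, which is integrable. *)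
Lemma weight_upper (al0 T : R) : 0 < al0 -> al0 <= al -> al0 <= T -> exists n,
  W al0 T <= C * phi al / al0 + 2 * C * D * (phi al / al) +
    2 * C * D * \sum_(j < n) increment j / dyad j.+1 * (dyad j.+1 < T)%R%:R.
Proof.
move=> al00 al0al al0T; have d0 : dyad 0 = al by rewrite /dyad expr0 mul1r.
have CD : 0 <= 2 * C * D by rewrite !mulr_ge0// ltW.
have a0E : phi al / al = a 0%N by rewrite /a d0.
have [Tal|alT] := leP T al.
  exists 0%N; rewrite big_ord0 mulr0 addr0.
  have : W al0 T <= C * phi al / al0.
    apply: (le_trans (W_le al00 al0T)).
    by rewrite ler_pM2r ?invr_gt0// ler_pM2l// phi_nd// (le_trans (ltW al00)).
  have : 0 <= 2 * C * D * (phi al / al) by apply: mulr_ge0 => //; rewrite a0E a_ge0.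
  lra.
have [k] := dyad_ub T; move=> /le_trans/(_ (dyad_le (leqnSn k))) Tk.
exists k; rewrite (WD al00 al0al (ltW alT)).
have := W_le al00 al0al; have := weight_dyad_sum _ Tk; rewrite d0 a0E => /(_ (ltW alT)).
rewrite mulrDr; lra.
Qed.

(** The Abel summation leaves a constant boundary term. The level [be] is so high that p grows by at
    least 1 between [al] and [be], whence be W >= 1 and the constant is absorbed into a multiple of
    W. *)
Lemma weight_lower (be T : R) n : al <= be -> C * phi al + 1 <= phi be -> be <= T ->
  \sum_(j < n) increment j.+1 / dyad j * (dyad j < T)%R%:R <=
  2 * D ^+ 2 * (C * phi al / al * be + 1) * W al T.
Proof.
move=> albe phibe beT; have d0 : dyad 0 = al by rewrite /dyad expr0 mul1r.
have be0 : 0 < be := lt_le_trans al_gt0 albe.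
have W1 : 1 <= be * W al T.
  rewrite (WD al_gt0 albe beT) mulrDr -[1]addr0 lerD//; last first.
    by rewrite mulr_ge0 ?(ltW be0)// W_ge0.
  rewrite -ler_pdivrMl// mulr1; apply: le_trans (Wge al_gt0 albe).
  rewrite -[X in X <= _]mul1r ler_pM2r ?invr_gt0//.
  by have := phip be0; have := pphi al_gt0; lra.
have WT0 : 0 <= W al T by rewrite W_ge0// (le_trans albe).
have X0 : 0 <= C * phi al / al.
  by rewrite divr_ge0 ?(ltW al_gt0)// mulr_ge0 ?phi_ge0// ltW.
apply: (@le_trans _ _ (2 * D ^+ 2 * (C * phi al / al + W al T))); last first.
  rewrite -[leRHS]mulrA ler_wpM2l ?mulr_ge0 ?exprn_ge0 ?(ltW D_gt0)//.
  rewrite mulrDl mul1r lerD2r -[leRHS]mulrA -[leLHS]mulr1.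
  by rewrite ler_wpM2l.
elim: n => [|n IH].
  by rewrite big_ord0 !mulr_ge0 ?exprn_ge0 ?(ltW D_gt0)// addr_ge0.
have [nT|Tn] := ltP (dyad n) T; last first.
  by rewrite big_ord_recr/= ltNge Tn/= mulr0 addr0.
(* Increments of [phi] are given up in favour of values, at the cost of two doublings, since only
   values can be passed on to p. *)
apply: (@le_trans _ _ (D ^+ 2 * \sum_(j < n.+1) p (dyad j) / dyad j)).
  rewrite mulr_sumr ler_sum// => j _.
  rewrite (_ : (_ < T)%R) ?mulr1; last by apply: le_lt_trans nT; apply: dyad_le; rewrite -ltnS.
  have dj := dyad_gt0 j.
  apply: (@le_trans _ _ (phi (dyad j.+2) / dyad j)).
    rewrite ler_pM2r ?invr_gt0// lerBlDr lerDl phi_ge0// dyad_ge0//.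
  apply: (le_trans (phi_shift_ratio j)).
  by rewrite ler_wpM2l ?exprn_ge0 ?(ltW D_gt0)// ler_pM2r ?invr_gt0// phip.
rewrite [leRHS](_ : _ = D ^+ 2 * (2 * (C * phi al / al + W al T))); last by ring.
rewrite ler_wpM2l ?exprn_ge0 ?(ltW D_gt0)//.
(* The same Abel summation as in [sum_ratio_le], now for the values of p, with the increments of W
   bounded below by [Wge]. *)
suff : \sum_(j < n.+1) p (dyad j) / dyad j + p (dyad n) / dyad n <=
    2 * (p al / al) + 2 * W al (dyad n).
  have : 0 <= p (dyad n) / dyad n by apply: divr_ge0; rewrite ?p_ge0 ?dyad_gt0.
  have : p al / al <= C * phi al / al by rewrite ler_pM2r ?invr_gt0// pphi.
  have : W al (dyad n) <= W al T.
    have aln : al <= dyad n by rewrite -d0 dyad_le.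
    by rewrite (WD al_gt0 aln (ltW nT)) lerDl W_ge0 ?dyad_gt0// ltW.
  lra.
elim: n {IH nT} => [|n IH].
  rewrite big_ord_recr big_ord0/= d0 add0r.
  by have := W_ge0 al_gt0 (lexx al); lra.
rewrite big_ord_recr/=.
have aln : al <= dyad n by rewrite -d0 dyad_le.
rewrite (WD al_gt0 aln (dyad_le (leqnSn n))).
have := Wge (dyad_gt0 n) (dyad_le (leqnSn n)).
have -> : (p (dyad n.+1) - p (dyad n)) / dyad n.+1 =
    p (dyad n.+1) / dyad n.+1 - p (dyad n) / dyad n / 2.
  rewrite mulrBl [in X in _ - X]dyadS; congr (_ - _); field.
  by rewrite gt_eqF// dyad_gt0.
lra.
Qed.

End weight.
End dyadic.

(** * Layer-cake series and their integrals *)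

Section layers.
Context d (T : measurableType d) (R : realType).
Variable mu : {measure set T -> \bar R}.
Local Open Scope ereal_scope.

(* No measurability: the integral of a nonnegative function is a supremum over
   the simple functions below it. *)
Lemma ge0_le_lower_integral (S1 S2 : set T) (f1 f2 : T -> \bar R) : S1 `<=` S2 ->
  (forall x, S1 x -> 0 <= f1 x) -> (forall x, S2 x -> 0 <= f2 x) ->
  (forall x, S1 x -> f1 x <= f2 x) ->
  \int[mu]_(x in S1) f1 x <= \int[mu]_(x in S2) f2 x.
Proof.
move=> S12 f10 f20 f12; rewrite !ge0_integralE//.
apply: ereal_sup_le => _ [h hf <-]; exists h => //= x.
apply: (le_trans (hf x)); rewrite /patch; case: ifPn => [/set_mem S1x|_].
  by rewrite ifT ?inE//; [exact: f12|exact: S12].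
by case: ifPn => [/set_mem/f20|].
Qed.

(** With u = 1 and superlevel sets of M f this discretises phi (M f); with u = |f| and superlevel
    sets of |f| it discretises |f| times the weight. *)
Definition layers (c : nat -> R) (A : nat -> set T) (u : T -> \bar R) (x : T) :=
  \sum_(j <oo) (c j)%:E * (u \_ (A j)) x.

Variables (c : nat -> R) (A : nat -> set T).
Hypothesis c0 : forall j, (0 <= c j)%R.

Section real_layers.
Variables (u : T -> \bar R) (x : T) (v : R) (b : nat -> bool).
Hypotheses (v0 : (0 <= v)%R) (ux : u x = v%:E).
Hypothesis Ab : forall j, (x \in A j) = b j.

Let partial n : \sum_(0 <= j < n) (c j)%:E * (u \_ (A j)) x =
  (v * \sum_(j < n) c j * (b j)%:R)%:E.
Proof.
rewrite big_mkord mulr_sumr -sumEFin; apply: eq_bigr => j _.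
rewrite /patch Ab; case: (b j); rewrite ?ux ?mulr1 ?mulr0 ?mule0//.
by rewrite -EFinM mulrC.
Qed.

Let term_ge0 j : 0 <= (c j)%:E * (u \_ (A j)) x.
Proof.
by rewrite mule_ge0 ?lee_fin// /patch; case: ifPn => // _; rewrite ux lee_fin.
Qed.

Lemma layers_ge n : (v * \sum_(j < n) c j * (b j)%:R)%:E <= layers c A u x.
Proof. by rewrite -partial; apply: nneseries_lim_ge. Qed.

Lemma layers_le (L : R) : (forall n, v * \sum_(j < n) c j * (b j)%:R <= L)%R ->
  layers c A u x <= L%:E.
Proof.
move=> H; apply: lime_le; first exact: is_cvg_nneseries.
by apply: nearW => n; rewrite partial lee_fin.
Qed.

End real_layers.

Lemma layers_ge0 (u : T -> \bar R) x : 0 <= u x -> 0 <= layers c A u x.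
Proof.
move=> u0; apply: nneseries_ge0 => j _ _; rewrite mule_ge0 ?lee_fin//.
by rewrite /patch; case: ifPn.
Qed.

Variables (u : T -> \bar R) (S : set T).
Hypotheses (mA : forall j, measurable (A j)) (mS : measurable S).
Hypotheses (mu0 : measurable_fun setT u) (u0 : forall x, 0 <= u x).

Let measurable_term j : measurable_fun S (fun x => (c j)%:E * (u \_ (A j)) x).
Proof.
apply: (@measurable_funS _ _ _ _ setT) => //; apply: measurable_funeM.
by apply/(measurable_restrictT _ _).1 => //; exact: measurable_funS mu0.
Qed.

Let restrict_ge0 j x : 0 <= (u \_ (A j)) x.
Proof. by rewrite /patch; case: ifPn. Qed.

Lemma measurable_layers : measurable_fun S (layers c A u).
Proof.
apply: ge0_emeasurable_sum => // j x _ _.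
by rewrite mule_ge0 ?lee_fin.
Qed.

Lemma integral_layers : \int[mu]_(x in S) layers c A u x =
  \sum_(j <oo) (c j)%:E * \int[mu]_(x in S `&` A j) u x.
Proof.
rewrite integral_nneseries//; last first.
  by move=> j x _; rewrite mule_ge0 ?lee_fin.
apply: eq_eseriesr => j _; rewrite ge0_integralZl_EFin//.
- by rewrite integral_mkcondr.
- apply: (@measurable_funS _ _ _ _ setT) => //.
  by apply/(measurable_restrictT _ _).1 => //; exact: measurable_funS mu0.
Qed.

End layers.

(** * Matching the two integrals, for an abstract measure and an abstract M *)

Section maximal_modular.
Context d (T : measurableType d) (R : realType).
Variable mu : {measure set T -> \bar R}.
Variables (B : set T) (f : T -> R) (M : T -> \bar R).
Variables (phi : R -> R) (D C : R) (p : T -> R -> R) (W : T -> R -> R -> R).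
Hypotheses (mB : measurable B) (Bfin : (mu B < +oo)%E).
Hypotheses (mf : measurable_fun setT f) (f_supp : forall x, f x != 0 -> B x).
Hypotheses (mM : measurable_fun setT M) (M_ge0 : forall x, (0 <= M x)%E).
Hypotheses (D_gt0 : 0 < D) (C_gt0 : 0 < C).
Hypothesis phi_ge0 : forall t, 0 <= t -> 0 <= phi t.
Hypothesis phi_nd : forall s t, 0 <= s -> s <= t -> phi s <= phi t.
Hypothesis phi_doubling : forall t, 0 <= t -> phi (2 * t) <= D * phi t.
Hypothesis phi_cvg : phi t @[t --> +oo] --> +oo.
Hypothesis p_ge0 : forall x t, 0 <= t -> 0 <= p x t.
Hypothesis phip : forall x t, B x -> 0 <= t -> phi t <= p x t.
Hypothesis pphi : forall x t, B x -> 0 <= t -> p x t <= C * phi t.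
Hypothesis p_nd : forall x s t, 0 <= s -> s <= t -> p x s <= p x t.
Hypothesis WD : forall x a b c, 0 < a -> a <= b -> b <= c ->
  W x a c = W x a b + W x b c.
Hypothesis Wge : forall x a b, 0 < a -> a <= b -> (p x b - p x a) / b <= W x a b.
Hypothesis Wle : forall x a b, 0 < a -> a <= b -> W x a b <= (p x b - p x a) / a.
Local Open Scope ereal_scope.

Let W_ge0 x a b : (0 < a)%R -> (a <= b)%R -> (0 <= W x a b)%R.
Proof.
move=> a0 ab; apply: le_trans (Wge x a0 ab).
rewrite divr_ge0 ?subr_ge0 ?p_nd//; first exact: ltW.
by rewrite (le_trans (ltW a0)).
Qed.

Let absf x := `|f x|%:E.

Let mabsf : measurable_fun setT absf.
Proof. by apply/measurable_EFinP; exact: measurableT_comp. Qed.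

Let absf_ge0 x : 0 <= absf x.
Proof. by rewrite lee_fin. Qed.

Let absf_supp x (t : R) : (0 <= t)%R -> (t < `|f x|)%R -> B x.
Proof. by move=> t0 tf; apply: f_supp; rewrite -normr_gt0 (le_lt_trans t0). Qed.

Let above (t : R) : set T := [set x | (t < `|f x|)%R].

Let measurable_above t : measurable (above t).
Proof. exact: measurable_abs_gt. Qed.

Let mem_above t x : (x \in above t) = (t < `|f x|)%R.
Proof. by apply/idP/idP; rewrite inE. Qed.

Let Mabove (t : R) : set T := [set x | t%:E < M x].

Let measurable_Mabove t : measurable (Mabove t).
Proof. by rewrite -[X in measurable X]setTI; exact: emeasurable_fun_o_infty. Qed.

Let mem_Mabove t x : (x \in Mabove t) = (t%:E < M x).
Proof. by apply/idP/idP; rewrite inE. Qed.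

Let one (x : T) : \bar R := 1.

Let mone : measurable_fun setT one.
Proof. exact: measurable_cst. Qed.

Let integral_one (S : set T) : measurable S -> \int[mu]_(x in S) one x = mu S.
Proof. by move=> mS; rewrite integral_cst// mul1e. Qed.

Notation dy := (dyad (1 : R)%R).
Notation inc := (increment (1 : R)%R phi).

Let dy_gt0 j : (0 < dy j)%R. Proof. exact: dyad_gt0. Qed.

Let inc_ge0 j : (0 <= inc j)%R. Proof. exact: increment_ge0. Qed.

Lemma maximal_modular_fin (w : R) :
  (forall l, (0 < l)%R -> mu (Mabove l) <=
     (2 / l * w)%:E * \int[mu]_(x in above (l / 2)) absf x) -> (0 <= w)%R ->
  \int[mu]_(x in above 1) (`|f x|%:E * (W x 1 `|f x|)%:E) < +oo ->
  \int[mu]_(x in B) ext_at_infty (p x) `|M x| < +oo.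
Proof.
move=> weak w0 Wfin.
have [be be1 phibe] : exists2 be : R, (1 <= be)%R & (C * phi 1 + 1 <= phi be)%R.
  have /cvgryPge/(_ (C * phi 1 + 1)%R)[L [_ HL]] := phi_cvg.
  exists (Num.max 1 (L + 1))%R; first by rewrite le_max lexx.
  by apply: HL; rewrite lt_max ltrDl ltr01 orbT.
have be0 : (0 < be)%R := lt_le_trans ltr01 be1.
pose K := (2 * D ^+ 2 * (C * phi 1 / 1 * be + 1))%R.
have K0 : (0 < K)%R.
  rewrite !mulr_gt0 ?exprn_gt0// ltr_wpDl// mulr_ge0 ?(ltW be0)// divr1 mulr_ge0 ?phi_ge0//.
  exact: ltW.
have low x t n : B x -> (be <= t)%R ->
    (\sum_(j < n) inc j.+1 / dy j * (dy j < t)%R%:R <= K * W x 1 t)%R.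
  move=> Bx bet; rewrite /K.
  apply: (weight_lower ltr01 D_gt0 phi_ge0 phi_doubling (p := p x) C_gt0) => //.
  - by move=> s s0; apply: phip => //; exact: ltW.
  - by move=> s s0; apply: pphi => //; exact: ltW.
  - exact: WD.
  - exact: Wge.
  - exact: p_nd.
pose c j := (inc j.+1 / dy j)%R.
have c0 j : (0 <= c j)%R by rewrite divr_ge0// ltW.
pose g := layers c (fun j => above (dy j)) absf.
have mg S : measurable S -> measurable_fun S g by move=> mS; exact: measurable_layers.
have gge0 x : 0 <= g x by exact: layers_ge0.
have g_above x : above be x -> g x <= K%:E * (`|f x|%:E * (W x 1 `|f x|)%:E).
  move=> bex; have Bx : B x by apply: absf_supp bex; exact: ltW.
  rewrite -!EFinM; apply: (layers_le c0 (normr_ge0 (f x)) erefl (fun j => mem_above (dy j) x)).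
  move=> n; rewrite mulrCA ler_wpM2l//; apply: low => //; exact: ltW.
(* Where |f| <= be, the sum is dominated by its value at [be], hence by K W x 1 be <= K C phi be;
   the remaining factor |f| is at most [be]. *)
pose L := (be * (K * (C * phi be)))%R.
have L0 : (0 <= L)%R.
  apply: mulr_ge0; first exact: ltW.
  apply: mulr_ge0; first exact: ltW.
  by apply: mulr_ge0; [exact: ltW|exact/phi_ge0/ltW].
have g_below x : ~ above be x -> g x <= L%:E.
  move=> /negP; rewrite /above/= -leNgt => fbe.
  apply: (layers_le c0 (normr_ge0 (f x)) erefl (fun j => mem_above (dy j) x)).
  move=> n; have [f0|fx0] := eqVneq (f x) 0%R; first by rewrite f0 normr0 mul0r.
  have Bx := f_supp fx0; apply: ler_pM => //.
    by apply: sumr_ge0 => j _; rewrite mulr_ge0.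
  apply: (@le_trans _ _ (\sum_(j < n) inc j.+1 / dy j * (dy j < be)%R%:R)%R).
    apply: ler_sum => j _; rewrite ler_wpM2l ?c0//.
    have [jf|] := ltP (dy j) `|f x|%R; last by rewrite ler0n.
    by rewrite (lt_le_trans jf fbe).
  apply: (le_trans (low x be n Bx (lexx _))); rewrite ler_pM2l//.
  apply: (le_trans (Wle x ltr01 be1)); rewrite divr1 lerBlDr.
  by rewrite (le_trans (pphi Bx (ltW be0)))// lerDl p_ge0.
have g_off x : ~ B x -> g x = 0.
  move=> nBx; apply/eqP; rewrite eq_le gge0 andbT.
  have f0 : f x = 0%R by apply/eqP/negPn/negP => /f_supp.
  apply: (layers_le c0 (normr_ge0 (f x)) erefl (fun j => mem_above (dy j) x)).
  by move=> n; rewrite f0 normr0 mul0r.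
have gfin : \int[mu]_x g x < +oo.
  have -> : \int[mu]_x g x = \int[mu]_(x in above be) g x + \int[mu]_(x in ~` above be) g x.
    rewrite -ge0_integral_setU ?setUCr//; last by rewrite disj_set2E setICr.
    - exact: measurableC.
    - exact: mg.
  apply: lte_add_pinfty.
    (* The constant is put on the side of the measurable series g, where it can be pulled out of the
       integral; the weighted integrand then enters only through a pointwise comparison. *)
    apply: (@le_lt_trans _ _ (K%:E * \int[mu]_(x in above be) ((K^-1)%:E * g x))).
      rewrite -ge0_integralZl_EFin//; last 3 first.
      - by move=> x _; rewrite mule_ge0// lee_fin invr_ge0 ltW.
      - by apply: measurable_funeM; exact: mg.
      - exact: ltW.
      under [leRHS]eq_integral do rewrite muleA -EFinM mulfV ?gt_eqF// mul1e.
      exact: lexx.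
    rewrite lte_mul_pinfty ?lee_fin ?(ltW K0)//; apply: le_lt_trans Wfin.
    apply: ge0_le_lower_integral.
    - by move=> x; apply: le_lt_trans.
    - by move=> x _; rewrite mule_ge0// lee_fin invr_ge0 ltW.
    - by move=> x fx; rewrite mule_ge0// lee_fin W_ge0// ltW.
    - move=> x /g_above gx; rewrite lee_pdivrMl//.
  apply: (@le_lt_trans _ _ (\int[mu]_(x in B) L%:E)); last first.
    by rewrite integral_cst// lte_mul_pinfty.
  rewrite integral_mkcond [leRHS]integral_mkcond; apply: ge0_le_lower_integral => //.
  - by move=> x _; rewrite /patch; case: ifPn.
  - by move=> x _; rewrite /patch; case: ifPn; rewrite ?lee_fin.
  - move=> x _; rewrite /patch; case: ifPn => [/set_mem/g_below gx|_].
      by case: ifPn => [//|/negP]; rewrite inE => /g_off ->.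
    by case: ifPn; rewrite ?lee_fin.
pose h := layers (fun j => inc j.+1) (fun j => Mabove (dy j.+1)) one.
have mh S : measurable S -> measurable_fun S h.
  by move=> mS; apply: measurable_layers => //; exact: measurable_cst.
have hge0 x : 0 <= h x by exact: layers_ge0.
have hfin : \int[mu]_(x in B) h x < +oo.
  rewrite integral_layers//.
  apply: (@le_lt_trans _ _ (w%:E * \int[mu]_x g x)); last by rewrite lte_mul_pinfty.
  rewrite integral_layers// -nneseriesZl; last first.
    by move=> j _; rewrite mule_ge0 ?lee_fin// integral_ge0.
  apply: lee_nneseries.
    by move=> j _ _; rewrite mule_ge0 ?lee_fin// integral_ge0.
  move=> j _; rewrite integral_one; last exact: measurableI.
  rewrite setTI.
  apply: (@le_trans _ _ ((inc j.+1)%:E * mu (Mabove (dy j.+1)))).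
    rewrite lee_wpmul2l ?lee_fin// le_measure ?inE//.
      exact: measurableI.
  apply: (le_trans (lee_wpmul2l _ (weak _ (dy_gt0 j.+1)))); first by rewrite lee_fin.
  have -> : (dy j.+1 / 2 = dy j)%R by rewrite dyadS; field.
  rewrite !muleA -!EFinM lee_wpmul2r ?integral_ge0// lee_fin /c dyadS.
  rewrite le_eqVlt; apply/orP; left; apply/eqP; field.
  by rewrite gt_eqF.
have phi1 := phi_ge0 (ltW (dy_gt0 1)).
apply: (@le_lt_trans _ _ (\int[mu]_(x in B) (C%:E * ((phi (dy 1))%:E + h x)))).
  apply: ge0_le_lower_integral => //.
  - move=> x _; rewrite gee0_abs//; case: (M x) (M_ge0 x) => //= t.
    by rewrite !lee_fin; exact: p_ge0.
  - by move=> x _; rewrite mule_ge0 ?lee_fin ?(ltW C_gt0)// adde_ge0 ?lee_fin.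
  - move=> x Bx; rewrite gee0_abs//.
    case Mx : (M x) (M_ge0 x) => [t| |]//=; last first.
      (* At such points the left side is +oo by convention. All indicators equal 1, and the
         increments have unbounded partial sums because [phi] tends to infinity. *)
      move=> _; suff -> : h x = +oo by rewrite addey// gt0_muley// lte_fin.
      apply/eqyP => Z Z0; have [n Zn] := sum_increment_unbounded ltr01 Z phi_cvg.
      have := @layers_ge _ T R (fun j => inc j.+1) (fun j => Mabove (dy j.+1))
        (fun j => inc_ge0 j.+1) one x 1%R xpredT ler01 erefl _ n.
      under eq_bigr do rewrite mulr1.
      rewrite mul1r => hn; apply: le_trans (hn _); first by rewrite lee_fin.
      by move=> j; rewrite mem_Mabove Mx ltry.
    rewrite lee_fin => t0.
    have [n tn] := phi_le_sum ltr01 phi_nd t0.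
    apply: (@le_trans _ _ (C * phi t)%:E); first by rewrite lee_fin pphi.
    rewrite EFinM lee_wpmul2l ?lee_fin ?(ltW C_gt0)//.
    apply: (@le_trans _ _
      (phi (dy 1) + \sum_(j < n) inc j.+1 * (dy j.+1 < t)%R%:R)%:E).
      by rewrite lee_fin.
    rewrite EFinD leeD2l//.
    have := @layers_ge _ T R (fun j => inc j.+1) (fun j => Mabove (dy j.+1))
      (fun j => inc_ge0 j.+1) one x 1%R (fun j => (dy j.+1 < t)%R) ler01 erefl _ n.
    rewrite mul1r; apply=> j.
    by rewrite mem_Mabove Mx lte_fin.
rewrite ge0_integralZl_EFin//; last 3 first.
- by move=> x _; rewrite adde_ge0// lee_fin.
- by apply: emeasurable_funD; [exact: measurable_cst|exact: mh].
- exact: ltW.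
rewrite lte_mul_pinfty ?lee_fin ?(ltW C_gt0)//.
rewrite ge0_integralD//; last first.
  exact: mh.
rewrite lte_add_pinfty// integral_cst// lte_mul_pinfty//.
Qed.

Lemma maximal_modular_inv (A k s0 al0 : R) :
  (0 < A)%R -> (0 < k)%R -> (0 < s0)%R ->
  (forall s, (s0 <= s)%R -> \int[mu]_(x in above s) absf x <=
     (A * s)%:E * mu (B `&` Mabove (k * s)%R)) ->
  \int[mu]_x absf x < +oo ->
  \int[mu]_(x in B) ext_at_infty (p x) `|M x| < +oo -> (0 < al0)%R ->
  \int[mu]_(x in above al0) (`|f x|%:E * (W x al0 `|f x|)%:E) < +oo.
Proof.
move=> A0 k0 s00 rev ffin Mfin al00.
(* Every level [t j] is then at least [s0], where [rev] applies, and at least the lower limit [al0]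
   of the weight. *)
pose al := Num.max al0 s0.
have al0al : (al0 <= al)%R by rewrite le_max lexx.
have s0al : (s0 <= al)%R by rewrite le_max lexx orbT.
have al_gt0 : (0 < al)%R := lt_le_trans al00 al0al.
pose t j := dyad al j.+1.
have t0 j : (0 < t j)%R by exact: dyad_gt0.
have tal j : (al <= t j)%R.
  by have := dyad_le al_gt0 (leq0n j.+1); rewrite [leLHS]/dyad expr0 mul1r.
pose i j := increment al phi j.
have i0 j : (0 <= i j)%R by exact: increment_ge0.
(* The factor k in {M > k t} is compensated by q doublings of [phi], each costing a factor D. *)
have [q kq] : exists q : nat, (k^-1 <= 2 ^+ q)%R.
  by have [q] := dyad_ub ltr01 (k^-1)%R; rewrite /dyad mulr1; exists q.
pose g := layers (fun j => i j / t j)%R (fun j => above (t j)) absf.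
pose h := layers i (fun j => Mabove (k * t j)%R) one.
have it0 j : (0 <= i j / t j)%R by rewrite divr_ge0// ltW.
have mg S : measurable S -> measurable_fun S g by move=> mS; exact: measurable_layers.
have mh S : measurable S -> measurable_fun S h by move=> mS; exact: measurable_layers.
have gge0 x : 0 <= g x by exact: layers_ge0.
have hge0 x : 0 <= h x by exact: layers_ge0.
have Dq : (0 < D ^+ q)%R by rewrite exprn_gt0.
have hfin : \int[mu]_(x in B) h x < +oo.
  have -> : \int[mu]_(x in B) h x =
      (D ^+ q)%:E * \int[mu]_(x in B) (((D ^+ q)^-1)%:E * h x).
    rewrite -ge0_integralZl_EFin//; last 3 first.
    - by move=> x _; rewrite mule_ge0// lee_fin invr_ge0 ltW.
    - by apply: measurable_funeM; exact: mh.
    - exact: ltW.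
    by apply: eq_integral => x _; rewrite muleA -EFinM mulfV ?gt_eqF// mul1e.
  rewrite lte_mul_pinfty ?lee_fin ?(ltW Dq)//; apply: le_lt_trans Mfin.
  apply: ge0_le_lower_integral => //.
  - by move=> x _; rewrite mule_ge0// lee_fin invr_ge0 ltW.
  - move=> x _; rewrite gee0_abs//; case: (M x) (M_ge0 x) => //= v.
    by rewrite !lee_fin; exact: p_ge0.
  - move=> x Bx; rewrite gee0_abs// lee_pdivrMl//.
    case Mx : (M x) (M_ge0 x) => [v| |]//=; last first.
      by move=> _; rewrite gt0_muley ?lte_fin// leey.
    rewrite lee_fin => v0; rewrite -EFinM.
    have Ab j : (x \in Mabove (k * t j)%R) = (k * t j < v)%R.
      by rewrite mem_Mabove Mx lte_fin.
    apply: (layers_le i0 ler01 erefl Ab) => n; rewrite mul1r.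
    apply: (le_trans (sum_le_phi al_gt0 D_gt0 phi_ge0 phi_nd phi_doubling n k0 kq v0)).
    by rewrite ler_pM2l// phip.
have gfin : \int[mu]_x g x < +oo.
  apply: (@le_lt_trans _ _ (A%:E * \int[mu]_(x in B) h x)); last first.
    by rewrite lte_mul_pinfty ?lee_fin ?(ltW A0)//.
  rewrite !integral_layers// -nneseriesZl; last first.
    by move=> j _; rewrite mule_ge0 ?lee_fin// integral_ge0.
  apply: lee_nneseries.
    by move=> j _ _; rewrite mule_ge0 ?lee_fin// integral_ge0.
  move=> j _; rewrite integral_one; last exact: measurableI.
  rewrite setTI.
  apply: (le_trans (lee_wpmul2l _ (rev _ (le_trans s0al (tal j))))); first by rewrite lee_fin.
  rewrite !muleA -!EFinM lee_wpmul2r// lee_fin.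
  rewrite le_eqVlt; apply/orP; left; apply/eqP; field.
  by rewrite gt_eqF.
pose C1 := (C * phi al / al0 + 2 * C * D * (phi al / al))%R.
pose C2 := (2 * C * D)%R.
have C20 : (0 <= C2)%R by rewrite !mulr_ge0// ltW.
have C10 : (0 <= C1)%R.
  have phial := phi_ge0 (ltW al_gt0).
  by rewrite addr_ge0// ?mulr_ge0 ?invr_ge0 ?(ltW C_gt0) ?(ltW D_gt0) ?(ltW al00) ?(ltW al_gt0).
apply: (@le_lt_trans _ _ (\int[mu]_x (C1%:E * absf x + C2%:E * g x))).
  apply: ge0_le_lower_integral => //.
  - by move=> x fx; rewrite mule_ge0// lee_fin W_ge0// ltW.
  - by move=> x _; rewrite adde_ge0// mule_ge0// lee_fin.
  - move=> x fx; have Bx : B x by apply: absf_supp fx; exact: ltW.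
    have fx' : (al0 <= `|f x|)%R by exact: ltW.
    have [n] : exists n, (W x al0 `|f x| <= C1 + C2 *
        \sum_(j < n) i j / t j * (t j < `|f x|)%R%:R)%R.
      apply: (weight_upper al_gt0 D_gt0 phi_ge0 phi_nd phi_doubling (p := p x)) => //.
      - by move=> s s0'; apply: phip => //; exact: ltW.
      - by move=> s s0'; apply: pphi => //; exact: ltW.
      - exact: WD.
      - exact: Wle.
    move=> Wn; rewrite -EFinM.
    apply: (@le_trans _ _ (C1 * `|f x| + C2 * (`|f x| *
        \sum_(j < n) i j / t j * (t j < `|f x|)%R%:R))%:E).
      rewrite lee_fin (le_trans (ler_wpM2l (normr_ge0 _) Wn))//.
      by rewrite mulrDr mulrC lerD2l mulrCA.
    rewrite EFinD !EFinM leeD2l// lee_wpmul2l// -EFinM.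
    exact: (layers_ge it0 (normr_ge0 (f x)) erefl (fun j => mem_above (t j) x)).
rewrite ge0_integralD//; last 4 first.
- by move=> x _; rewrite mule_ge0// lee_fin.
- exact: measurable_funeM.
- by move=> x _; rewrite mule_ge0// lee_fin.
- by apply: measurable_funeM; exact: mg.
rewrite !ge0_integralZl_EFin//; last first.
  exact: mg.
by apply: lte_add_pinfty; rewrite lte_mul_pinfty ?lee_fin.
Qed.

End maximal_modular.

(** * Application to the Hardy-Littlewood maximal function *)

Theorem theorem5 (R : realType) (d : nat) (d_gt0 : (0 < d)%N)
    (Psi psi : 'rV[R]_d -> R -> R)
    (Psi_ge0 : forall x (t : R), 0 <= t -> 0 <= Psi x t)
    (Psi_measurable :
      measurable_fun ([set p | 0 <= p.2] : set (Lebesgue_rV_R R d))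
        (fun p => Psi p.1 p.2))
    (psi_integrable : forall x (t : R), 0 <= t ->
      completed_lebesgue_measure.-integrable `[0, t] (fun s => (psi x s)%:E))
    (PsiE : forall x (t : R), 0 <= t ->
      (Psi x t)%:E =
      (\int[completed_lebesgue_measure]_(s in `[0%R, t]) (psi x s)%:E)%E)
    (Psi0 : forall x, Psi x 0 = 0)
    (Psi_increasing : forall x (s t : R), 0 <= s -> s <= t -> Psi x s <= Psi x t)
    (Psi_gt0 : forall x (t : R), 0 < t -> 0 < Psi x t)
    (Psi_cvgy : forall x, Psi x t @[t --> +oo] --> +oo)
    (Psi_doubling : exists C0 : R, 0 < C0 /\
      forall x (t : R), 0 <= t -> Psi x (2 * t) <= C0 * Psi x t)
    (Psi_compact : forall K : set 'rV[R]_d, compact K -> K !=set0 ->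
      exists (x1 x2 : 'rV[R]_d) (CK : R), [/\ K x1, K x2, 0 < CK &
        forall x (t : R), K x -> 0 < t ->
          [/\ CK^-1 * Psi x2 t <= Psi x1 t, Psi x1 t <= Psi x t,
              Psi x t <= Psi x2 t & Psi x2 t <= CK * Psi x1 t]])
    (psi_div_integral : forall alpha0 beta0 : R, 0 < alpha0 -> alpha0 < beta0 ->
      forall x, (\int[completed_lebesgue_measure]_(s in `[alpha0, beta0])
        (psi x s / s)%:E < +oo)%E)
    (c : 'rV[R]_d) (r : R) (r_gt0 : 0 < r)
    (ball_proper : closed_eball c r `<` [set: 'rV[R]_d])
    (f : 'rV[R]_d -> R)
    (f_measurable : measurable_fun [set: Lebesgue_rV R d] f)
    (f_supp : closure [set x | f x != 0] `<=` closed_eball c r) :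
  LPsi Psi (closed_eball c r) (hardy_littlewood f) <->
  forall alpha0 : R, 0 < alpha0 ->
    (\int[lebesgue_rV]_(x in [set x | (alpha0 < `|f x|)%R])
       (`|f x|%:E *
        \int[completed_lebesgue_measure]_(s in `[alpha0, `|f x|%R])
          (psi x s / s)%:E) < +oo)%E.
Proof.
pose B : set (Lebesgue_rV R d) := closed_eball c r.
have mB : measurable B by exact: measurable_closed_eball.
have supp : [set x | f x != 0] `<=` closed_eball c r.
  by apply: subset_trans f_supp; exact: subset_closure.
have Bc : closed_eball c r c.
  by rewrite /closed_eball/= subrr enorm0 ltW.
have [x1 [x2 [CK [_ _ CK0 comp]]]] :=
  Psi_compact (closed_eball c r) (@compact_closed_eball _ _ c r) (ex_intro _ c Bc).
have [C0 [C00 dbl]] := Psi_doubling.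
have phip x t : B x -> 0 <= t -> Psi x1 t <= Psi x t.
  move=> Bx; rewrite le_eqVlt => /predU1P[<-|t0]; first by rewrite !Psi0.
  by have [] := comp x t Bx t0.
have pphi x t : B x -> 0 <= t -> Psi x t <= CK * Psi x1 t.
  move=> Bx; rewrite le_eqVlt => /predU1P[<-|t0]; first by rewrite !Psi0 mulr0.
  by have [_ _ h1 h2] := comp x t Bx t0; exact: le_trans h1 h2.
pose W x := weighted (psi x).
have WD x a b e : 0 < a -> a <= b -> b <= e -> W x a e = W x a b + W x b e.
  by move=> a0 ab be; exact: (weightedD (psi_integrable x) a0 ab be).
have Wbd x a b : 0 < a -> a <= b ->
    (Psi x b - Psi x a) / b <= W x a b <= (Psi x b - Psi x a) / a.
  by move=> a0 ab; exact: (weighted_bounds (psi_integrable x) (PsiE x) (@Psi_increasing x) a0 ab).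
have Wge x a b : 0 < a -> a <= b -> (Psi x b - Psi x a) / b <= W x a b.
  by move=> a0 ab; have /andP[] := Wbd x a b a0 ab.
have Wle x a b : 0 < a -> a <= b -> W x a b <= (Psi x b - Psi x a) / a.
  by move=> a0 ab; have /andP[] := Wbd x a b a0 ab.
have Bfin : (lebesgue_rV B < +oo)%E.
  apply: le_lt_trans (lebesgue_ball_lty c (r + 1)); apply: le_measure; rewrite ?inE.
  - exact: mB.
  - exact: measurable_ball_lebesgue.
  - by apply: closed_eball_sub_ball; rewrite ltrDl.
have mM := measurable_hardy_littlewood d_gt0 f_measurable.
have M0 := hardy_littlewood_ge0 d_gt0 f_measurable.
have NE a0 : 0 < a0 -> (\int[lebesgue_rV]_(x in [set x | (a0 < `|f x|)%R])
       (`|f x|%:E * \int[completed_lebesgue_measure]_(s in `[a0, `|f x|%R])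
          (psi x s / s)%:E) =
     \int[lebesgue_rV]_(x in [set x | (a0 < `|f x|)%R]) (`|f x|%:E * (W x a0 `|f x|)%:E))%E.
  move=> a00; apply: eq_integral => x _.
  by rewrite (weightedE (psi_integrable x) _ a00).
split=> [[_ Mfin] a0 a00|H].
- rewrite NE//.
  (* If M f were infinite throughout B, the modular would be infinite, as B has positive measure. At
     a point x of B with M f x finite, the ball of radius 3 r around x contains B, hence the support
     of f, and its average bounds the whole integral of |f|. *)
  have Ifin : (abs_density lebesgue_rV f_measurable setT < +oo)%E.
    have [x [Bx Mx]] : exists x, B x /\ (hardy_littlewood f x < +oo)%E.
      apply: contrapT => /forallNP noM; move: Mfin; apply/negP; rewrite -leNgt.
      have -> : (\int[lebesgue_rV]_(x in closed_eball c r)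
          ext_at_infty (Psi x) `|hardy_littlewood f x| = \int[lebesgue_rV]_(x in B) +oo)%E.
        apply: eq_integral => x /set_mem Bx.
        have : ~ (hardy_littlewood f x < +oo)%E by move=> Mx; apply: (noM x).
        by move=> /negP; rewrite -leNgt leye_eq => /eqP ->.
      rewrite integral_cst; last exact: mB.
      rewrite gt0_mulye//; apply: (@lt_le_trans _ _ (lebesgue_rV (eball c r))).
        apply: lt_le_trans (lebesgue_eball_ge d_gt0 c r_gt0).
        by rewrite lte_fin exprn_gt0// divr_gt0// ltr0n.
      apply: le_measure; rewrite ?inE.
      - exact: measurable_eball.
      - exact: mB.
      - by move=> y; exact: ltW.
    have r30 : 0 < 3 * r by rewrite mulr_gt0.
    have BS : closed_eball c r `<=` eball x (3 * r).
      move=> y; rewrite /closed_eball /eball/= => yB.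
      apply: (le_lt_trans (ler_enorm_sub y c x)).
      have : enorm (c - x) <= r by rewrite enormB.
      by move: yB r_gt0; clear; lra.
    rewrite -(abs_density_supp f_measurable supp (measurable_eball x (3 * r)) BS).
    have [m Mm] : exists m : R, hardy_littlewood f x = m%:E.
      by exists (fine (hardy_littlewood f x)); rewrite fineK// ge0_fin_numE.
    have Mle : (hardy_littlewood f x <= m%:E)%E by rewrite Mm.
    apply: (le_lt_trans (hardy_littlewood_leP d_gt0 f_measurable Mle r30)).
    have [v _ ->] := lebesgue_eball_fin d_gt0 x r30.
    by rewrite -EFinM ltry.
  have [A [k [s0 [A0 k0 s00 rev]]]] := reverse_weak_type d_gt0 r_gt0 supp Ifin.
  exact: (maximal_modular_inv mB f_measurable supp mM M0 C00 CK0
    (Psi_ge0 x1) (@Psi_increasing x1) (dbl x1) (Psi_ge0) phip pphi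
    Psi_increasing WD Wge Wle A0 k0 s00 rev Ifin Mfin a00).
- split; first exact: measurable_funS mM.
  (* The lower limit 1 is the bottom level of the dyadic sequence used in [maximal_modular_fin]. *)
  have := H 1 ltr01; rewrite NE//.
  have weak := weak_type d_gt0 f_measurable.
  apply: (maximal_modular_fin mB Bfin f_measurable supp mM M0 C00 CK0
    (Psi_ge0 x1) (@Psi_increasing x1) (dbl x1) (@Psi_cvgy x1) Psi_ge0 phip pphi
    Psi_increasing WD Wge Wle weak).
  by rewrite /weak_const exprn_ge0// mulr_ge0.
Qed.
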